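(* (Generalized symmetry principle.) Any symmetry in the initial data of the Cauchy problem for Bryant surfaces generates a global symmetry of the resulting Bryant surface. That is: let $\beta:I\to\mathbb{H}^3$, $V:I\to\mathbb{S}^3_1$ be Björling data, let $\Phi$ be a positive (orientation-preserving) rigid motion of $\mathbb{H}^3$ for which there is an analytic diffeomorphism $\Psi:I\to I$ with $\beta\circ\Psi=\Phi\circ\beta$ and $V\circ\Psi=d\Phi\circ V$, and let $\psi$ be the only solution to the Cauchy problem for Bryant surfaces with initial data $\beta,V$. Then $\Phi$ is a global symmetry of $\psi$: if $\tilde\Psi$ is a holomorphic extension of $\Psi$, then $\psi\circ\tilde\Psi=\Phi\circ\psi$.
   Context: $\mathbb{L}^4$ is $\mathbb{R}^4$ with $\langle,\rangle=-dx_0^2+dx_1^2+dx_2^2+dx_3^2$; $\mathbb{H}^3=\{\langle x,x\rangle=-1,\ x_0>0\}$, $\mathbb{S}^3_1=\{\langle x,x\rangle=1\}$. The cross product is $\langle u_1\times u_2\times u_3,w\rangle=\det(u_1,u_2,u_3,w)$, and $u\wedge v=p\times u\times v$ for $u,v\in T_p\mathbb{H}^3$. A Bryant surface is an immersion $\psi:\Sigma\to\mathbb{H}^3$ with unit normal $\eta:\Sigma\to\mathbb{S}^3_1$ in $\mathbb{H}^3$ for which the mean curvature is $1$ (convention $d\eta=-d\psi\circ S$, $H=\frac12\mathrm{tr}\,S$); $\Sigma$ carries the induced conformal structure, oriented so that $\psi_t=\eta\wedge\psi_s$ for conformal parameters $z=s+it$. Björling data: a regular analytic curve $\beta:I\to\mathbb{H}^3$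 ($I$ an open real interval) and an analytic $V:I\to\mathbb{S}^3_1$ with $\langle\beta,V\rangle\equiv\langle\beta',V\rangle\equiv0$. The Cauchy problem for Bryant surfaces with initial data $\beta,V$ has a unique solution, i.e. a conformally parametrized Bryant surface $\psi:D\subseteq\mathbb{C}\to\mathbb{H}^3$, with $D$ a neighbourhood of $I\equiv I\times\{0\}$, such that $\psi(s,0)=\beta(s)$ and $\eta(s,0)=V(s)$; uniqueness is as germs along $I$, and equalities of maps extend by analytic continuation. *)

(* Defs.v *)
From HB Require Import structures.
From mathcomp Require Import all_boot all_order all_algebra.
From mathcomp Require Import all_classical all_reals all_analysis.
From mathcomp Require Import complex.
Set Implicit Arguments.
Unset Strict Implicit.
Unset Printing Implicit Defensive.
Import Order.TTheory GRing.Theory Num.Theory.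
Import numFieldNormedType.Exports.
Local Open Scope classical_set_scope.
Local Open Scope ring_scope.

Definition lor (R : realType) (u v : 'rV[R]_4) : R :=
  \sum_(i < 4) (if i == 0 then -1 else 1) * u 0 i * v 0 i.

Definition hyp3 (R : realType) : set 'rV[R]_4 :=
  [set x | lor x x = -1 /\ 0 < x 0 0].

Definition desitter3 (R : realType) : set 'rV[R]_4 := [set x | lor x x = 1].

Definition det4 (R : realType) (u1 u2 u3 u4 : 'rV[R]_4) : R :=
  \det (\matrix_(i < 4) [:: u1; u2; u3; u4]`_i).

(* The coordinates are forced by [lor_cross] below: the sign of the metric
   on the basis vector e_i times det(u1, u2, u3, e_i). *)
Definition cross (R : realType) (u1 u2 u3 : 'rV[R]_4) : 'rV[R]_4 :=
  \row_(i < 4) ((if i == 0 then -1 else 1) * det4 u1 u2 u3 (delta_mx 0 i)).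

Lemma lor_cross (R : realType) (u1 u2 u3 w : 'rV[R]_4) :
  lor (cross u1 u2 u3) w = det4 u1 u2 u3 w.
Proof.
have detE x : det4 u1 u2 u3 x =
    \sum_(j < 4) x 0 j *
      cofactor (\matrix_(i < 4) [:: u1; u2; u3; 0]`_i) (inord 3) j.
  rewrite /det4 (expand_det_row _ (inord 3)); apply: eq_bigr => j _.
  rewrite !mxE inordK //=; congr (_ * (_ * \det _)).
  apply/matrixP => k l; rewrite !mxE.
  have k3 : (lift (inord 3 : 'I_4) k < 3)%N.
    have k3 : (k < 3)%N := ltn_ord k.
    by rewrite /= inordK // /bump (leqNgt 3 k) k3.
  by move: k3; case: (nat_of_ord (lift _ _)) => [|[|[|]]].
rewrite /lor detE; apply: eq_bigr => i _.
rewrite /cross mxE detE (bigD1 i) //= big1 ?addr0 => [|j jNi]; last first.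
  by rewrite mxE (negPf jNi) andbF mul0r.
rewrite mxE !eqxx mul1r mulrA mulrC; congr (_ * _).
by case: (i == 0); rewrite ?mulN1r ?opprK ?mul1r.
Qed.

(* Meant for u, v tangent to the hyperbolic space at p. *)
Definition wedge (R : realType) (p u v : 'rV[R]_4) : 'rV[R]_4 := cross p u v.

(* Rigid motions of the hyperboloid are the restrictions of the linear
   isometries of Minkowski space preserving it.  Since p and the tangent space
   at p span Minkowski space, orientation is preserved iff [\det L] is 1. *)
Definition positive_rigid_motion (R : realType)
    (Phi : 'rV[R]_4 -> 'rV[R]_4) : Prop :=
  exists L : 'M[R]_4,
    [/\ forall u v, lor (u *m L) (v *m L) = lor u v,
        forall x, hyp3 x -> hyp3 (x *m L),
        \det L = 1
      & Phi = fun x => x *m L].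

(* The parameter plane: [p : 'rV[R]_2] is the complex number z = s + i t *)

Definition pt (R : realType) (s t : R) : 'rV[R]_2 :=
  \row_(j < 2) (if j == 0 then s else t).

Definition cplx (R : realType) (p : 'rV[R]_2) : R[i] := (p 0 0 +i* p 0 1)%C.

Definition plane (R : realType) (z : R[i]) : 'rV[R]_2 :=
  pt (complex.Re z) (complex.Im z).

Definition axis (R : realType) (I : set R) : set 'rV[R]_2 :=
  [set pt s 0 | s in I].

(* Complex differentiability on U: the difference quotients are taken in the
   field [R[i]], viewed as a normed space over itself. *)
Definition holomorphic_on (R : realType) (U : set 'rV[R]_2)
    (F : 'rV[R]_2 -> 'rV[R]_2) : Prop :=
  forall p, U p ->
    derivable (fun z : R[i]^o => (cplx (F (plane z)) : R[i]^o)) (cplx p) 1.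

Fixpoint Ck_on (R : realType) (D : set 'rV[R]_2) (k : nat)
    (f : 'rV[R]_2 -> 'rV[R]_4) : Prop :=
  if k is k'.+1 then
    (forall p, D p -> differentiable f p) /\ forall v, Ck_on D k' ('D_v f)
  else forall p, D p -> {for p, continuous f}.

Definition smooth_on (R : realType) (D : set 'rV[R]_2)
    (f : 'rV[R]_2 -> 'rV[R]_4) : Prop :=
  forall k, Ck_on D k f.

Definition dds (R : realType) (f : 'rV[R]_2 -> 'rV[R]_4) : 'rV[R]_2 -> 'rV[R]_4 :=
  'D_(pt 1 0) f.

Definition ddt (R : realType) (f : 'rV[R]_2 -> 'rV[R]_4) : 'rV[R]_2 -> 'rV[R]_4 :=
  'D_(pt 0 1) f.

Definition analytic_on (R : realType) (E : normedModType R)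
    (I : set R) (f : R -> E) : Prop :=
  forall x0, I x0 -> exists a : nat -> E, exists2 r : R, 0 < r &
    forall x, `|x - x0| < r ->
      series (fun k => (x - x0) ^+ k *: a k) @ \oo --> f x.

Definition open_interval (R : realType) (I : set R) : Prop :=
  [/\ is_interval I, open I & I !=set0].

Definition analytic_diffeo (R : realType) (I : set R) (Psi : R -> R) : Prop :=
  [/\ set_bij I I Psi, analytic_on I (Psi : R -> R^o) &
      exists2 Psi' : R -> R, analytic_on I (Psi' : R -> R^o) &
        forall s, I s -> Psi' (Psi s) = s].

(* Vectors of the parameter plane are rows, so the endomorphism S acts by
   [u |-> u *m S] and the equation reads d eta = - d psi o S. *)
Definition shape_operator (R : realType) (psi eta : 'rV[R]_2 -> 'rV[R]_4)
    (p : 'rV[R]_2) (S : 'M[R]_2) : Prop :=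
  forall u : 'rV[R]_2, 'd eta p u = - 'd psi p (u *m S).

(* For an immersion, S is determined by psi and eta. *)
Definition mean_curvature (R : realType) (psi eta : 'rV[R]_2 -> 'rV[R]_4)
    (p : 'rV[R]_2) (h : R) : Prop :=
  exists2 S : 'M[R]_2, shape_operator psi eta p S & h = 2^-1 * \tr S.

(* [psi] and [eta] are total functions; only their values on the open set D
   are constrained. *)
Record conformal_bryant (R : realType) (D : set 'rV[R]_2)
    (psi eta : 'rV[R]_2 -> 'rV[R]_4) : Prop := ConformalBryant {
  bryant_open : open D ;
  bryant_smooth : smooth_on D psi ;
  bryant_normal_smooth : smooth_on D eta ;
  bryant_hyp3 : forall p, D p -> hyp3 (psi p) ;
  bryant_immersion : forall p, D p -> injective ('d psi p) ;
  bryant_desitter3 : forall p, D p -> desitter3 (eta p) ;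
  bryant_normal_tangent : forall p, D p -> lor (eta p) (psi p) = 0 ;
  bryant_normal : forall p, D p ->
    forall u : 'rV[R]_2, lor (eta p) ('d psi p u) = 0 ;
  bryant_conformal : forall p, D p ->
    lor (dds psi p) (dds psi p) = lor (ddt psi p) (ddt psi p) /\
    lor (dds psi p) (ddt psi p) = 0 ;
  bryant_orientation : forall p, D p ->
    ddt psi p = wedge (psi p) (eta p) (dds psi p) ;
  bryant_mean_curvature : forall p, D p -> mean_curvature psi eta p 1 }.

Record bjorling_data (R : realType) (I : set R) (beta V : R -> 'rV[R]_4) : Prop :=
  BjorlingData {
  bjorling_curve_analytic : analytic_on I beta ;
  bjorling_field_analytic : analytic_on I V ;
  bjorling_curve_hyp3 : forall s, I s -> hyp3 (beta s) ;
  bjorling_field_desitter3 : forall s, I s -> desitter3 (V s) ;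
  bjorling_regular : forall s, I s -> derive1 beta s != 0 ;
  bjorling_orth : forall s, I s -> lor (beta s) (V s) = 0 ;
  bjorling_orth_deriv : forall s, I s -> lor (derive1 beta s) (V s) = 0 }.

Record cauchy_solution (R : realType) (I : set R) (beta V : R -> 'rV[R]_4)
    (D : set 'rV[R]_2) (psi eta : 'rV[R]_2 -> 'rV[R]_4) : Prop :=
  CauchySolution {
  cauchy_bryant : conformal_bryant D psi eta ;
  cauchy_domain : axis I `<=` D ;
  cauchy_curve : forall s, I s -> psi (pt s 0) = beta s ;
  cauchy_normal : forall s, I s -> eta (pt s 0) = V s }.

Record holomorphic_extension (R : realType) (I : set R) (Psi : R -> R)
    (U : set 'rV[R]_2) (tPsi : 'rV[R]_2 -> 'rV[R]_2) : Prop :=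
  HolomorphicExtension {
  hext_open : open U ;
  hext_domain : axis I `<=` U ;
  hext_holomorphic : holomorphic_on U tPsi ;
  hext_extends : forall s, I s -> tPsi (pt s 0) = pt (Psi s) 0 }.

(* Main.v *)
(* In the Hermitian model of Minkowski space, a conformal immersion psi into the
   hyperboloid has mean curvature 1 (for the given orientation) exactly when the
   traceless matrix alpha = psi_z psi^-1 is holomorphic.  Both psi o tPsi and
   Phi o psi have this property, tPsi being allowed critical points, because
   alpha(psi o tPsi) = tPsi' (alpha(psi) o tPsi).  On the axis the symmetry of the
   initial data makes the 1-jets of the two maps agree, hence the two forms alpha
   agree there, hence everywhere by the identity theorem; and then
   psi_z = alpha psi is a linear equation, whose solution is determined by its
   value at one point.

   The identity theorem has to be proved for functions that are complex
   differentiable only once, without Cauchy's formula.  Goursat's lemma provides a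
   primitive F of such a function; on a disc where F vanishes near the centre q,
   the weight exp (k / |z - q|^2) with k large turns the maximum principle for
   log |F|^2, a harmonic function, into F = 0 (a Carleman-type argument). *)
Require Import Defs.
From HB Require Import structures.
From mathcomp Require Import all_boot all_order all_algebra.
From mathcomp Require Import all_classical all_reals all_analysis.
From mathcomp Require Import complex.
From mathcomp Require Import ring lra.
Import Order.TTheory GRing.Theory Num.Theory.
Import numFieldNormedType.Exports.
Local Open Scope classical_set_scope.
Local Open Scope ring_scope.
Set Implicit Arguments.
Unset Strict Implicit.
Unset Printing Implicit Defensive.

(** * One real variable *)

Section OneVariable.
Context {R : realType}.
Implicit Types (f g : R -> R) (a b c x y : R).

(** No second-order equation can be written for [psi o tPsi], since [tPsi] is visibly differentiable
    only once. This surface is therefore handled through its form alone, and the identity theorem is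
    about functions that are complex derivatives. The weight argument differentiates [|F|^2] twice
    at a maximum, so it cannot be run on the form or on its primitive [f]: it is run on a primitive
    of [f]. It also wants an open set of zeros, while the data provide zeros on a line only; cutting
    off one side of the line supplies the open set.

    On the axis, the tangential derivatives agree because the curves do. The normal derivatives then
    agree because the orientation relation [b = cross x h a] recovers [b] from the position, the
    normal and [a]; this is where the field [V] and the determinant of the rigid motion enter.

    Once the forms agree, the difference of the two maps solves a linear system with bounded
    coefficients, and Gronwall's inequality along a horizontal and then a vertical segment makes it
    vanish. All this is local, on squares; connectedness of the domain globalizes it. *)

Lemma small_pos x y : 0 < x -> 0 < y -> exists2 m, 0 < m & m < x /\ m < y.
Proof.
move=> x0 y0; have [xy|yx] := leP x y; first by exists (x / 2); lra.
by exists (y / 2); lra.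
Qed.

(** The order of the endpoints is left open so that mean value arguments need no case distinction on
    their position. *)
Definition btw a b x := a <= x <= b \/ b <= x <= a.

Lemma btw_sub a b x : btw a b x -> `|x - a| <= `|b - a|.
Proof.
case=> /andP[h1 h2].
  by rewrite !ger0_norm ?subr_ge0 ?lerD2r// (le_trans h1).
by rewrite !ler0_norm ?subr_le0 ?lerN2 ?lerD2r// (le_trans h1).
Qed.

Lemma btw_ball a b x c (r : R) :
  `|a - c| < r -> `|b - c| < r -> btw a b x -> `|x - c| < r.
Proof. by rewrite !ltr_norml /btw => *; lra. Qed.

Lemma ball_near (x x0 x' r : R) : `|x' - x| < r - `|x - x0| -> `|x' - x0| < r.
Proof. by move=> h; have := ler_normD (x' - x) (x - x0); rewrite subrKA; lra. Qed.

(** Multiplying out the difference quotient admits [y = x] and gives the one-variable case of the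
    estimate in [diff2]. *)
Lemma is_derive_epsP f x (l : R) :
  is_derive x (1 : R) f l <->
  forall e : R, 0 < e -> exists2 d : R, 0 < d &
    forall y, `|y - x| < d -> `|f y - f x - l * (y - x)| <= e * `|y - x|.
Proof.
split=> [[df fl] e e0|H].
  have : (fun h => h^-1 *: (f (h *: (1:R) + x) - f x)) @ 0^' --> l.
    by rewrite -fl; apply: df.
  move/cvgrPdist_le => /(_ _ e0) [d /= d0 Hd]; exists d => // y yd.
  have [->|yx] := eqVneq y x; first by rewrite !subrr mulr0 subrr !normr0 mulr0.
  have := Hd (y - x); rewrite /ball_/= sub0r normrN => /(_ yd).
  rewrite subr_eq0 => /(_ yx); rewrite /GRing.scale/= mulr1 subrK => He.
  have yx0 : y - x != 0 by rewrite subr_eq0.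
  have -> : f y - f x - l * (y - x) = - (l - (y - x)^-1 * (f y - f x)) * (y - x).
    by field.
  by rewrite normrM normrN ler_wpM2r.
have cv : (fun h => h^-1 *: (f (h *: (1:R) + x) - f x)) @ 0^' --> l.
  apply/cvgrPdist_le => e e0; have [d d0 Hd] := H _ e0.
  exists d => //= h; rewrite /ball_/= sub0r normrN => hd h0.
  have := Hd (h + x); rewrite addrK => /(_ hd) He.
  rewrite /GRing.scale/= mulr1.
  have -> : l - h^-1 * (f (h + x) - f x) = - (f (h + x) - f x - l * h) * h^-1.
    by field.
  by rewrite normrM normrN normfV ler_pdivrMr ?normr_gt0.
by split; [apply/cvg_ex; exists l|apply: cvg_lim].
Qed.

Lemma is_derive_cont f x (l : R) : is_derive x (1 : R) f l -> {for x, continuous f}.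
Proof. by case=> /derivable1_diffP/differentiable_continuous. Qed.

Lemma mvt_btw f g a b : (forall x, btw a b x -> is_derive x (1 : R) f (g x)) ->
  exists2 c, btw a b c & f b - f a = g c * (b - a).
Proof.
move=> H.
have W u v : u <= v -> (forall x, u <= x <= v -> is_derive x (1 : R) f (g x)) ->
    exists2 c, u <= c <= v & f v - f u = g c * (v - u).
  move=> uv Huv; case: (@MVT_segment R f g u v uv).
  - move=> x; rewrite in_itv/= => /andP[/ltW h1 /ltW h2].
    by apply: Huv; rewrite h1.
  - apply: continuous_in_subspaceT => x; rewrite inE/= in_itv/= => xuv.
    exact: is_derive_cont (Huv _ xuv).
  - by move=> c; rewrite in_itv/=; exists c.
have [ab|/ltW ba] := leP a b.
  by have [x xab|c cab ->] := W a b ab; [apply: H; left|exists c => //; left].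
have [x xab|c cab E] := W b a ba; first by apply: H; right.
by exists c; [right|rewrite -[LHS]opprB E -mulrN opprB].
Qed.

(* The weaker hypothesis on the second derivative, which need only exist at
   the maximum, is what lets the maximum principle run on functions that are
   not known to be C^2. *)
Lemma local_max_second f g x (l d : R) : 0 < d ->
  (forall y, `|y - x| < d -> is_derive y (1 : R) f (g y)) ->
  is_derive x (1 : R) g l -> (forall y, `|y - x| < d -> f y <= f x) ->
  g x = 0 /\ l <= 0.
Proof.
move=> d0 Hf /is_derive_epsP Hg Hm.
have gx : g x = 0.
  have /is_derive_epsP Hx : is_derive x (1 : R) f (g x).
    by apply: Hf; rewrite subrr normr0.
  apply/eqP; rewrite -normr_eq0; apply/negPn/negP => gx0.
  have e0 : 0 < `|g x| / 2 by rewrite divr_gt0// lt_def gx0/=.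
  have [d' d'0 Hd'] := Hx _ e0.
  have [m m0 [md md']] := small_pos d0 d'0.
  have := Hd' (x + m); rewrite [_ + _ - x]addrC addKr gtr0_norm// => /(_ md').
  have := Hd' (x - m); rewrite [_ - _ - x]addrC addKr normrN gtr0_norm// => /(_ md').
  have := Hm (x + m); rewrite [_ + _ - x]addrC addKr gtr0_norm// => /(_ md).
  have := Hm (x - m); rewrite [_ - _ - x]addrC addKr normrN gtr0_norm// => /(_ md).
  rewrite !ler_norml => h1 h2 /andP[h3 h4] /andP[h5 h6].
  have : 0 < `|g x| * m by rewrite mulr_gt0// lt_def gx0/=.
  by move: h3 h4 h5 h6; case: (ger0P (g x)) => h; lra.
split=> //; rewrite leNgt; apply/negP => l0.
have e0 : 0 < l / 2 by rewrite divr_gt0.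
have [d' d'0 Hd'] := Hg _ e0.
have [m m0 [md md']] := small_pos d0 d'0.
(* The mean value point may be an endpoint, hence the two halves: on the right one [c > x] makes
   [g c] positive, on the left one [0 <= g c'] suffices. Together they give [f x < f (x + m)]. *)
have [y xy|c xc] := @mvt_btw f g (x + m / 2) (x + m).
  by apply: Hf; rewrite ltr_norml; move: xy; rewrite /btw; lra.
have [y xy|c' xc'] := @mvt_btw f g x (x + m / 2).
  by apply: Hf; rewrite ltr_norml; move: xy; rewrite /btw; lra.
have xmm : f (x + m) <= f x by apply: Hm; rewrite ltr_norml; lra.
have := Hd' c'; have := Hd' c; rewrite gx !ltr_norml !ler_norml => Hc Hc'.
have {}Hc : 0 < g c.
  have cx : 0 < c - x by move: xc; rewrite /btw; lra.
  have := Hc ltac:(move: xc; rewrite /btw; lra).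
  by rewrite gtr0_norm//; nra.
have {}Hc' : 0 <= g c'.
  have cx : 0 <= c' - x by move: xc'; rewrite /btw; lra.
  have := Hc' ltac:(move: xc'; rewrite /btw; lra).
  by rewrite ger0_norm//; nra.
by nra.
Qed.

(** The margin between [r'] and [r] keeps the closed interval of radius [r'] inside the domain of
    continuity; its left end is the base point of the integral. *)
Lemma antiderivative g c (r r' : R) : 0 < r' < r ->
  (forall x, `|x - c| < r -> {for x, continuous g}) ->
  exists G, forall x, `|x - c| < r' -> is_derive x (1 : R) G (g x).
Proof.
move=> /andP[r0 rr] Hg.
exists (fun x => (\int[lebesgue_measure]_(t in `[(c - r')%R, x]) g t)%R) => x xc.
have xu : x < c + r' by move: xc; rewrite ltr_norml; lra.
have ax : c - r' < x by move: xc; rewrite ltr_norml; lra.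
have [||] := @continuous_FTC1_closed R g (c - r') x (c + r') xu _ ax.
- apply: continuous_compact_integrable; first exact: segment_compact.
  apply: continuous_in_subspaceT => y; rewrite inE/= in_itv/= => yuv.
  by apply: Hg; rewrite ltr_norml; lra.
- by apply: Hg; exact: lt_trans xc rr.
- by move=> dF <-; rewrite derive1E; apply: DeriveDef.
Qed.

End OneVariable.

(** * Goursat's lemma *)

Section Bisection.
Context {R : realType}.
Implicit Types (a c w h x y : R).

(** Nested intervals: [x] is the supremum of the left ends, which is at most every right end. *)
Lemma bisection_limit (a : nat -> R) w : 0 <= w ->
  (forall n, a n.+1 = a n \/ a n.+1 = a n + w / 2 ^+ n.+1) ->
  exists x, forall n, a n <= x <= a n + w / 2 ^+ n.
Proof.
move=> w0 H.
have wn n : 0 <= w / 2 ^+ n by rewrite divr_ge0// exprn_ge0.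
have half n : w / 2 ^+ n = w / 2 ^+ n.+1 + w / 2 ^+ n.+1.
  by rewrite exprS; field; rewrite expf_neq0.
have mono n k : a n <= a (n + k)%N /\ a (n + k)%N + w / 2 ^+ (n + k) <= a n + w / 2 ^+ n.
  elim: k => [|k IH]; first by rewrite addn0.
  rewrite addnS; have := wn (n + k).+1; have := half (n + k)%N.
  by case: (H (n + k)%N) => ->; lra.
pose S := range a.
have S0 : S !=set0 by exists (a 0%N), 0%N.
have ub n : ubound S (a n + w / 2 ^+ n).
  move=> _ [m _ <-]; have [nm|/ltnW mn] := leqP n m.
    by have [_] := mono n (m - n)%N; rewrite subnKC//; have := wn m; lra.
  by have [] := mono m (n - m)%N; rewrite subnKC//; have := wn n; lra.
exists (sup S) => n; apply/andP; split; last exact: ge_sup.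
by apply: ub_le_sup; [exists (a 0%N + w / 2 ^+ 0); exact: ub|exists n].
Qed.

Lemma pow2_small w (d : R) : 0 < d -> exists n, w / 2 ^+ n < d.
Proof.
move=> d0; exists (Num.truncn (w / d)).+1.
rewrite ltr_pdivrMr ?exprn_gt0// mulrC -ltr_pdivrMr//.
apply: (lt_le_trans (truncnS_gt _)).
by rewrite -natrX ler_nat ltnW// ltn_expl.
Qed.

(* [bad a c w h] concerns the rectangle with lower left corner [(a, c)], width
   [w] and height [h]. *)
Lemma quadrisection (bad : R -> R -> R -> R -> Prop) a c w h :
  0 <= w -> 0 <= h ->
  (forall a c w h, bad a c w h ->
    exists a' c', [/\ a' = a \/ a' = a + w / 2, c' = c \/ c' = c + h / 2 &
                      bad a' c' (w / 2) (h / 2)]) ->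
  bad a c w h ->
  exists x y, [/\ a <= x <= a + w, c <= y <= c + h & forall d : R, 0 < d ->
    exists a' c' w' h', [/\ bad a' c' w' h', a' <= x <= a' + w',
      c' <= y <= c' + h', 0 <= w' < d & 0 <= h' < d]].
Proof.
move=> w0 h0 step bad0.
(* The index belongs to the state because the current sides are computed from it. On a rectangle
   that is not bad the choice is a dummy. *)
have /choice[next nextP] : forall z : nat * (R * R), exists z' : R * R,
    bad z.2.1 z.2.2 (w / 2 ^+ z.1) (h / 2 ^+ z.1) ->
    [/\ z'.1 = z.2.1 \/ z'.1 = z.2.1 + w / 2 ^+ z.1.+1,
        z'.2 = z.2.2 \/ z'.2 = z.2.2 + h / 2 ^+ z.1.+1 &
        bad z'.1 z'.2 (w / 2 ^+ z.1.+1) (h / 2 ^+ z.1.+1)].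
  move=> -[n [a1 c1]]/=.
  have [b|nb] := pselect (bad a1 c1 (w / 2 ^+ n) (h / 2 ^+ n)); last by exists (a1, c1).
  have [a' [c' []]] := step _ _ _ _ b.
  have -> : w / 2 ^+ n / 2 = w / 2 ^+ n.+1.
    by rewrite exprS; field; rewrite expf_neq0.
  have -> : h / 2 ^+ n / 2 = h / 2 ^+ n.+1.
    by rewrite exprS; field; rewrite expf_neq0.
  by move=> h1 h2 h3; exists (a', c').
pose z := fix z n := if n is m.+1 then next (m, z m) else (a, c).
have zbad n : bad (z n).1 (z n).2 (w / 2 ^+ n) (h / 2 ^+ n).
  elim: n => [|n IH]; first by rewrite expr0 !divr1.
  by have [] := nextP (n, z n) IH.
have [x Hx] : exists x, forall n, (z n).1 <= x <= (z n).1 + w / 2 ^+ n.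
  apply: (@bisection_limit (fun n => (z n).1)) => // n.
  by have [] := nextP (n, z n) (zbad n).
have [y Hy] : exists y, forall n, (z n).2 <= y <= (z n).2 + h / 2 ^+ n.
  apply: (@bisection_limit (fun n => (z n).2)) => // n.
  by have [] := nextP (n, z n) (zbad n).
exists x, y; split.
- by have := Hx 0%N; rewrite expr0 divr1.
- by have := Hy 0%N; rewrite expr0 divr1.
move=> d d0; have [n Hn] := pow2_small (w + h) d0.
exists (z n).1, (z n).2, (w / 2 ^+ n), (h / 2 ^+ n).
have := Hn; rewrite mulrDl.
have wn : 0 <= w / 2 ^+ n by rewrite divr_ge0// exprn_ge0.
have hn : 0 <= h / 2 ^+ n by rewrite divr_ge0// exprn_ge0.
by split; [exact: zbad|exact: Hx|exact: Hy|rewrite wn/=; lra|rewrite hn/=; lra].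
Qed.

End Bisection.

Section Goursat.
Context {R : realType}.
Implicit Types (f p q A : R -> R -> R) (a b c d s t r : R).

(** Differentiability at a single point, with no condition on the partial derivatives elsewhere:
    this is all that Goursat's argument consumes. *)
Definition diff2 f s t a b := forall e : R, 0 < e -> exists2 d : R, 0 < d &
  forall s' t', `|s' - s| < d -> `|t' - t| < d ->
    `|f s' t' - f s t - a * (s' - s) - b * (t' - t)| <=
    e * (`|s' - s| + `|t' - t|).

Lemma diff2_swap f s t a b :
  diff2 f s t a b -> diff2 (fun x y => f y x) t s b a.
Proof.
move=> H e e0; have [d d0 Hd] := H e e0; exists d => // s' t' h1 h2.
by have := Hd t' s' h2 h1; rewrite [`|t' - s| + _]addrC addrAC.
Qed.

Lemma diff2_derive1 f s t a b :
  diff2 f s t a b -> is_derive s (1 : R) (f ^~ t) a.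
Proof.
move=> H; apply/is_derive_epsP => e e0; have [d d0 Hd] := H e e0.
exists d => // y yd; have := Hd y t yd; rewrite !subrr normr0 mulr0 subr0 addr0.
exact.
Qed.

Lemma diff2_derive2 f s t a b :
  diff2 f s t a b -> is_derive t (1 : R) (f s) b.
Proof. by move=> /diff2_swap/diff2_derive1. Qed.

Section Rectangle.
Variables (s0 t0 r : R) (p q P Q : R -> R -> R).
Hypothesis dP : forall s t, `|s - s0| < r -> `|t - t0| < r ->
  is_derive s (1 : R) (P t) (p s t).
Hypothesis dQ : forall s t, `|s - s0| < r -> `|t - t0| < r ->
  is_derive t (1 : R) (Q s) (q s t).
(** The form [p ds - q dt] is closed, in the pointwise sense: the [t]-derivative of [p] and the
    [s]-derivative of [q] are opposite. *)
Hypothesis closed_pq : forall s t, `|s - s0| < r -> `|t - t0| < r ->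
  exists a b c, diff2 p s t a b /\ diff2 q s t (- b) c.

(* Minus the integral of the 1-form [p ds - q dt] along the boundary of the
   rectangle with opposite corners [(a, c)] and [(b, d)]. *)
Let J a b c d :=
  (P d b - P d a) - (P c b - P c a) + ((Q b d - Q b c) - (Q a d - Q a c)).

(** Opposite sides are subtracted before the mean value theorem is applied. The affine parts of [p]
    and [q] then contribute [l * h * w] and [- l * w * h], which cancel by closedness; each of the
    two remainders is at most [2 * e * (w + h)] times a side. *)
Lemma rectangle_local a c w h x y (e D : R) :
  0 < e -> `|a - s0| < r -> `|a + w - s0| < r -> `|c - t0| < r ->
  `|c + h - t0| < r -> a <= x <= a + w -> c <= y <= c + h -> 0 <= w -> 0 <= h ->
  w < D -> h < D ->
  (exists k l m,
     (forall s' t', `|s' - x| < D -> `|t' - y| < D ->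
     `|p s' t' - p x y - k * (s' - x) - l * (t' - y)| <= e * (`|s' - x| + `|t' - y|))
  /\ (forall s' t', `|s' - x| < D -> `|t' - y| < D ->
     `|q s' t' - q x y - - l * (s' - x) - m * (t' - y)| <= e * (`|s' - x| + `|t' - y|))) ->
  `|J a (a + w) c (c + h)| <= 2 * e * (w + h) ^+ 2.
Proof.
move=> e0 ha hb hc hd xw yh w0 h0 wD hD [k [l [m [Hp Hq]]]].
have inx s : a <= s <= a + w -> [/\ `|s - s0| < r, `|s - x| < D & `|s - x| <= w].
  by move: ha hb; rewrite !ltr_norml !ler_norml => *; split; lra.
have iny t : c <= t <= c + h -> [/\ `|t - t0| < r, `|t - y| < D & `|t - y| <= h].
  by move: hc hd; rewrite !ltr_norml !ler_norml => *; split; lra.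
have aw : a <= a + w by rewrite lerDl.
have ch : c <= c + h by rewrite lerDl.
have [c1 c2 c3] : [/\ `|c - t0| < r, `|c - y| < D & `|c - y| <= h].
  by apply: iny; rewrite lexx.
have [d1 d2 d3] : [/\ `|c + h - t0| < r, `|c + h - y| < D & `|c + h - y| <= h].
  by apply: iny; rewrite lexx andbT.
have [a1 a2 a3] : [/\ `|a - s0| < r, `|a - x| < D & `|a - x| <= w].
  by apply: inx; rewrite lexx.
have [b1 b2 b3] : [/\ `|a + w - s0| < r, `|a + w - x| < D & `|a + w - x| <= w].
  by apply: inx; rewrite lexx andbT.
have [s ss Es] := @mvt_btw R (fun s => P (c + h) s - P c s - l * h * s)
   (fun s => p s (c + h) - p s c - l * h) a (a + w) ltac:(
   by move=> s [/inx[h1 _ _]|/andP[? ?]];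
      [|have [|h1 _ _] := inx s; first lra];
      have := dP h1 d1; have := dP h1 c1 => dc dd;
      apply: is_derive_eq; rewrite /GRing.scale/=; ring).
have [t tt Et] := @mvt_btw R (fun t => Q (a + w) t - Q a t + l * w * t)
   (fun t => q (a + w) t - q a t + l * w) c (c + h) ltac:(
   by move=> t [/iny[h1 _ _]|/andP[? ?]];
      [|have [|h1 _ _] := iny t; first lra];
      have := dQ a1 h1; have := dQ b1 h1 => dc dd;
      apply: is_derive_eq; rewrite /GRing.scale/=; ring).
have [s1 s2 s3] : [/\ `|s - s0| < r, `|s - x| < D & `|s - x| <= w].
  by apply: inx; move: ss; rewrite /btw; lra.
have [t1 t2 t3] : [/\ `|t - t0| < r, `|t - y| < D & `|t - y| <= h].
  by apply: iny; move: tt; rewrite /btw; lra.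
have le2 (u v : R) : u <= w -> v <= h -> e * (u + v) <= e * (w + h).
  by move=> uw vh; rewrite ler_pM2l// lerD.
have Bs : `|p s (c + h) - p s c - l * h| <= 2 * e * (w + h).
  have := le_trans (Hp s (c + h) s2 d2) (le2 _ _ s3 d3).
  have := le_trans (Hp s c s2 c2) (le2 _ _ s3 c3).
  by rewrite !ler_norml; lra.
have Bt : `|q (a + w) t - q a t + l * w| <= 2 * e * (w + h).
  have := le_trans (Hq a t a2 t2) (le2 _ _ a3 t3).
  have := le_trans (Hq (a + w) t b2 t2) (le2 _ _ b3 t3).
  by rewrite !ler_norml; lra.
have -> : J a (a + w) c (c + h) = (p s (c + h) - p s c - l * h) * w
    + (q (a + w) t - q a t + l * w) * h.
  by rewrite /J; move: Es Et; lra.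
apply: (le_trans (ler_normD _ _)); rewrite !normrM (ger0_norm w0) (ger0_norm h0).
have := ler_wpM2r w0 Bs; have := ler_wpM2r h0 Bt; nra.
Qed.

Lemma rectangle_zero_pos a w c h : `|a - s0| < r -> `|a + w - s0| < r ->
  `|c - t0| < r -> `|c + h - t0| < r -> 0 <= w -> 0 <= h ->
  J a (a + w) c (c + h) = 0.
Proof.
move=> ha hb hc hd w0 h0.
apply/eqP; rewrite -normr_le0; apply/ler_addgt0Pr => e e0.
(* The added 1 keeps the divisor positive for a degenerate rectangle. *)
pose k := (w + h) ^+ 2 + 1.
have k0 : 0 < k by rewrite ltr_wpDl// sqr_ge0.
pose e' := e / k; have e'0 : 0 < e' by rewrite divr_gt0.
rewrite add0r; suff : `|J a (a + w) c (c + h)| <= e' * (w + h) ^+ 2.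
  move/le_trans; apply; rewrite /e' mulrAC ler_pdivrMr// ler_pM2l//.
  by rewrite /k lerDl.
rewrite leNgt; apply/negP => bad0.
(* [J] is additive under subdivision and [(w + h) ^+ 2] drops to a quarter under halving, so a bad
   rectangle has a bad quarter. *)
pose bad a1 c1 w1 h1 := [/\ e' * (w1 + h1) ^+ 2 < `|J a1 (a1 + w1) c1 (c1 + h1)|,
  a <= a1 /\ a1 + w1 <= a + w, c <= c1 /\ c1 + h1 <= c + h, 0 <= w1 & 0 <= h1].
have [|x [y [xw yh sml]]] := @quadrisection R bad a c w h w0 h0 _ ltac:(by split).
  move=> a1 c1 w1 h1 [big [aa1 aw1] [cc1 ch1] w10 h10].
  apply: contrapT => nbad.
  have good a' c' : a' = a1 \/ a' = a1 + w1 / 2 -> c' = c1 \/ c' = c1 + h1 / 2 ->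
      `|J a' (a' + w1 / 2) c' (c' + h1 / 2)| <= e' * (w1 / 2 + h1 / 2) ^+ 2.
    move=> ea ec; rewrite leNgt; apply/negP => big'; apply: nbad.
    exists a', c'; split => //.
    split; [exact: big'| | |lra|lra].
      by case: ea => ->; lra.
    by case: ec => ->; lra.
  have g1 := good a1 c1 (or_introl erefl) (or_introl erefl).
  have g2 := good a1 _ (or_introl erefl) (or_intror erefl).
  have g3 := good _ c1 (or_intror erefl) (or_introl erefl).
  have g4 := good _ _ (or_intror erefl) (or_intror erefl).
  move: big; rewrite ltNge => /negP; apply.
  have dbl (u v : R) : u + v / 2 + v / 2 = u + v by field.
  move: g1 g2 g3 g4; rewrite !dbl => g1 g2 g3 g4.
  have -> : J a1 (a1 + w1) c1 (c1 + h1) =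
    J a1 (a1 + w1 / 2) c1 (c1 + h1 / 2) + J a1 (a1 + w1 / 2) (c1 + h1 / 2) (c1 + h1)
  + J (a1 + w1 / 2) (a1 + w1) c1 (c1 + h1 / 2)
  + J (a1 + w1 / 2) (a1 + w1) (c1 + h1 / 2) (c1 + h1) by rewrite /J; ring.
  move: g1 g2 g3 g4; rewrite !ler_norml.
  have -> : e' * (w1 / 2 + h1 / 2) ^+ 2 = e' * (w1 + h1) ^+ 2 / 4 by field.
  lra.
have xr : `|x - s0| < r by move: ha hb; rewrite !ltr_norml => *; lra.
have yr : `|y - t0| < r by move: hc hd; rewrite !ltr_norml => *; lra.
have [k1 [l1 [m1 [Dp Dq]]]] := closed_pq xr yr.
(* Halving [e'] absorbs the factor 2 of [rectangle_local]. *)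
have e2 : 0 < e' / 2 by rewrite divr_gt0.
have [d1 d10 Hp] := Dp _ e2; have [d2 d20 Hq] := Dq _ e2.
have [d d0 [dd1 dd2]] := small_pos d10 d20.
have [a' [c' [w' [h' [[big [aa' aw'] [cc' ch'] w'0 h'0] xa yc]]]]] := sml _ d0.
move=> /andP[_ w'd] /andP[_ h'd].
move: big; rewrite ltNge => /negP; apply.
have -> : e' * (w' + h') ^+ 2 = 2 * (e' / 2) * (w' + h') ^+ 2 by field.
apply: (@rectangle_local a' c' w' h' x y (e' / 2) d) => //.
- by move: ha hb; rewrite !ltr_norml => *; lra.
- by move: ha hb; rewrite !ltr_norml => *; lra.
- by move: hc hd; rewrite !ltr_norml => *; lra.
- by move: hc hd; rewrite !ltr_norml => *; lra.
exists k1, l1, m1; split=> s' t' h1 h2.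
  by apply: Hp; exact: lt_trans dd1.
by apply: Hq; exact: lt_trans dd2.
Qed.

Lemma rectangle_zero a b c d : `|a - s0| < r -> `|b - s0| < r ->
  `|c - t0| < r -> `|d - t0| < r -> J a b c d = 0.
Proof.
have W a' b' c' d' : `|a' - s0| < r -> `|b' - s0| < r ->
    `|c' - t0| < r -> `|d' - t0| < r -> a' <= b' -> c' <= d' -> J a' b' c' d' = 0.
  move=> ha hb hc hd ab cd.
  have := @rectangle_zero_pos a' (b' - a') c' (d' - c').
  by rewrite ![_ + (_ - _)]addrC !subrK !subr_ge0; exact.
move=> ha hb hc hd.
have [ab|/ltW ab] := leP a b; have [cd|/ltW cd] := leP c d.
- exact: W.
- by have := W a b d c ha hb hd hc ab cd; rewrite /J; lra.
- by have := W b a c d hb ha hc hd ab cd; rewrite /J; lra.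
- by have := W b a d c hb ha hd hc ab cd; rewrite /J; lra.
Qed.

End Rectangle.

End Goursat.

(** * Primitives of closed forms on a square *)

Section Poincare.
Context {R : realType}.
Implicit Types (f p q A : R -> R -> R) (a b c d s t r : R).

Lemma diff2_cont1 f s t a b : diff2 f s t a b -> {for s, continuous (f ^~ t)}.
Proof. by move=> /diff2_derive1/is_derive_cont. Qed.

Lemma poincare p q s0 t0 r r' : 0 < r' < r ->
  (forall s t, `|s - s0| < r -> `|t - t0| < r ->
    exists a b c, diff2 p s t a b /\ diff2 q s t (- b) c) ->
  exists A, forall s t, `|s - s0| < r' -> `|t - t0| < r' ->
    is_derive s (1 : R) (A ^~ t) (p s t) /\ is_derive t (1 : R) (A s) (- q s t).
Proof.
move=> rr H.
have [r'0 r'r] := andP rr.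
(* Primitives on different lines are chosen independently of each other; only their increments along
   a single line enter below. *)
have /choice[P HP] : forall t, exists g : R -> R,
    `|t - t0| < r' -> forall s, `|s - s0| < r' -> is_derive s (1 : R) g (p s t).
  move=> t.
  have [tr|/negP tr] := boolP (`|t - t0| < r'); last by exists (fun=> 0).
  have [|g Hg] := @antiderivative R (p ^~ t) s0 r r' rr.
    move=> s sr; have [a [b [c [/diff2_cont1]]]] := H s t sr (lt_trans tr r'r).
    by [].
  by exists g => _ s; exact: Hg.
have /choice[Q HQ] : forall s, exists g : R -> R,
    `|s - s0| < r' -> forall t, `|t - t0| < r' -> is_derive t (1 : R) g (q s t).
  move=> s.
  have [sr|/negP sr] := boolP (`|s - s0| < r'); last by exists (fun=> 0).
  have [|g Hg] := @antiderivative R (q s) t0 r r' rr.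
    move=> t tr; have [a [b [c [_ /diff2_derive2]]]] := H s t (lt_trans sr r'r) tr.
    exact: is_derive_cont.
  by exists g => _ t; exact: Hg.
have s0r : `|s0 - s0| < r' by rewrite subrr normr0.
have t0r : `|t0 - t0| < r' by rewrite subrr normr0.
(* The two staircase paths from [(s0, t0)] to [(s, t)] give the same value. The primitive is defined
   by the left-hand path, whose [t]-derivative is immediate; its [s]-derivative is read off the
   right-hand one. *)
have E s t : `|s - s0| < r' -> `|t - t0| < r' ->
    P t0 s - P t0 s0 - (Q s t - Q s t0) = P t s - P t s0 - (Q s0 t - Q s0 t0).
  move=> sr tr.
  have := @rectangle_zero R s0 t0 r' p q P Q (fun s t h1 h2 => HP t h2 s h1) (fun s t h1 h2 => HQ s h1 t h2)
    (fun s t h1 h2 => H s t (lt_trans h1 r'r) (lt_trans h2 r'r)) s0 s t0 t s0r sr t0r tr.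
  by lra.
exists (fun s t => P t0 s - P t0 s0 - (Q s t - Q s t0)) => s t sr tr; split.
  have dd := HP t tr s sr.
  have [d /= d0 dE] : exists2 d, 0 < d & forall s', `|s' - s| < d -> `|s' - s0| < r'.
    by exists (r' - `|s - s0|) => [|s' s's]; [rewrite subr_gt0|exact: ball_near s's].
  have dF : is_derive s (1 : R) (fun s => P t s - P t s0 - (Q s0 t - Q s0 t0)) (p s t).
    by apply: is_derive_eq; rewrite !subr0.
  move/is_derive_epsP in dF; apply/is_derive_epsP => e e0.
  have [d' d'0 Hd'] := dF _ e0; have [m m0 [md md']] := small_pos d0 d'0.
  exists m => // y ym; rewrite !E//; first exact/Hd'/(lt_trans ym).
  exact/dE/(lt_trans ym).
have dd := HQ s sr t tr.
have dF : is_derive t (1 : R) (fun t => P t0 s - P t0 s0 - (Q s t - Q s t0)) (- q s t).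
  have dB := is_deriveB dd (is_derive_cst (Q s t0) t (1 : R)).
  have := is_deriveB (is_derive_cst (P t0 s - P t0 s0) t (1 : R)) dB.
  by rewrite subr0 sub0r.
exact: dF.
Qed.

End Poincare.

(** * Complex differentiability *)

Section ComplexDifferentiability.
Context {R : realType}.
Implicit Types (f g F : R -> R -> R) (a b c d s t r : R).

Lemma diff2_lip f s t a b : diff2 f s t a b ->
  exists2 K : R, 0 < K & exists2 d : R, 0 < d & forall s' t',
    `|s' - s| < d -> `|t' - t| < d ->
    `|f s' t' - f s t| <= K * (`|s' - s| + `|t' - t|).
Proof.
move=> H; exists (`|a| + `|b| + 1).
  by have := normr_ge0 a; have := normr_ge0 b; lra.
have [d d0 Hd] := H 1 ltr01; exists d => // s' t' h1 h2.
have := Hd s' t' h1 h2; set X := f s' t' - f s t => HX.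
have -> : X = (X - a * (s' - s) - b * (t' - t)) + a * (s' - s) + b * (t' - t) by ring.
apply: (le_trans (ler_normD _ _)); rewrite normrM.
have := ler_normD (X - a * (s' - s) - b * (t' - t)) (a * (s' - s)).
rewrite normrM.
have := mulr_ge0 (normr_ge0 a) (normr_ge0 (t' - t)).
have := mulr_ge0 (normr_ge0 b) (normr_ge0 (s' - s)).
lra.
Qed.

Definition cont2 f s t := forall e : R, 0 < e -> exists2 d : R, 0 < d &
  forall s' t', `|s' - s| < d -> `|t' - t| < d -> `|f s' t' - f s t| <= e.

Lemma diff2_cont2 f s t a b : diff2 f s t a b -> cont2 f s t.
Proof.
move=> /diff2_lip[K K0 [d d0 H]] e e0.
have eK : 0 < e / (2 * K) by rewrite divr_gt0// mulr_gt0.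
have [m m0 [m1 m2]] := small_pos d0 eK.
exists m => // s' t' h1 h2.
apply: (le_trans (H _ _ (lt_trans h1 m1) (lt_trans h2 m1))).
rewrite mulrC -ler_pdivlMr//.
have -> : e / K = e / (2 * K) + e / (2 * K) by field; rewrite gt_eqF.
by move: (lt_trans h1 m2) (lt_trans h2 m2); lra.
Qed.

Lemma cont2_continuous f s t :
  cont2 f s t -> {for (s, t), continuous (fun z : R * R => f z.1 z.2)}.
Proof.
move=> H; apply/cvgrPdist_le => e e0; have [d d0 Hd] := H e e0.
near=> z; rewrite distrC; apply: Hd.
  rewrite distrC; near: z.
  by apply: (@cvgr_dist_lt _ _ _ (nbhs (s, t)) _ fst s) => //; exact: cvg_fst.
rewrite distrC; near: z.
by apply: (@cvgr_dist_lt _ _ _ (nbhs (s, t)) _ snd t) => //; exact: cvg_snd.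
Unshelve. all: by end_near. Qed.

Lemma diff2_comp F (u v : R -> R -> R) s t a b (u1 u2 v1 v2 : R) :
  diff2 F (u s t) (v s t) a b -> diff2 u s t u1 u2 -> diff2 v s t v1 v2 ->
  diff2 (fun x y => F (u x y) (v x y)) s t (a * u1 + b * v1) (a * u2 + b * v2).
Proof.
move=> HF Hu Hv e e0.
have [Ku Ku0 [du du0 Lu]] := diff2_lip Hu; have [Kv Kv0 [dv dv0 Lv]] := diff2_lip Hv.
(* Half of [e] pays for the remainder of [F], whose increments are at most [Ku + Kv] times that of
   the variables; the other half pays for the remainders of [u] and [v], amplified by [|a|] and
   [|b|]. The added 1 makes [A] a legal divisor. *)
pose A := `|a| + `|b| + 1.
have A0 : 0 < A by rewrite /A; have := normr_ge0 a; have := normr_ge0 b; lra.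
have K0 : 0 < Ku + Kv by rewrite addr_gt0.
have e10 : 0 < e / 2 / A by rewrite !divr_gt0.
have e20 : 0 < e / 2 / (Ku + Kv) by rewrite !divr_gt0.
have [d1 d10 H1] := Hu _ e10; have [d2 d20 H2] := Hv _ e10.
have [d3 d30 H3] := HF _ e20.
have [du' du'0 Cu] := diff2_cont2 Hu (divr_gt0 d30 (ltr0n R 2)).
have [dv' dv'0 Cv] := diff2_cont2 Hv (divr_gt0 d30 (ltr0n R 2)).
have [m1 m10 [m1a m1b]] := small_pos d10 d20.
have [m2 m20 [m2a m2b]] := small_pos du0 dv0.
have [m3 m30 [m3a m3b]] := small_pos du'0 dv'0.
have [m4 m40 [m4a m4b]] := small_pos m10 m20.
have [m m0 [ma mb]] := small_pos m40 m30.
exists m => // s' t' h1 h2.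
have lt41 := lt_trans ma m4a; have lt42 := lt_trans ma m4b.
have tr x y : x < m -> m < y -> x < y := fun h1 h2 => lt_trans h1 h2.
have {}H1 := H1 _ _ (tr _ _ h1 (lt_trans lt41 m1a)) (tr _ _ h2 (lt_trans lt41 m1a)).
have {}H2 := H2 _ _ (tr _ _ h1 (lt_trans lt41 m1b)) (tr _ _ h2 (lt_trans lt41 m1b)).
have {}Lu := Lu _ _ (tr _ _ h1 (lt_trans lt42 m2a)) (tr _ _ h2 (lt_trans lt42 m2a)).
have {}Lv := Lv _ _ (tr _ _ h1 (lt_trans lt42 m2b)) (tr _ _ h2 (lt_trans lt42 m2b)).
have {}Cu := Cu _ _ (tr _ _ h1 (lt_trans mb m3a)) (tr _ _ h2 (lt_trans mb m3a)).
have {}Cv := Cv _ _ (tr _ _ h1 (lt_trans mb m3b)) (tr _ _ h2 (lt_trans mb m3b)).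
have d3h : d3 / 2 < d3 by rewrite ltr_pdivrMr// mulr_natr mulr2n ltrDl.
have {}H3 := H3 _ _ (le_lt_trans Cu d3h) (le_lt_trans Cv d3h).
set x := s' - s in H1 H2 Lu Lv *; set y := t' - t in H1 H2 Lu Lv *.
set n := `|x| + `|y| in H1 H2 Lu Lv *.
set U := u s' t' - u s t in H1 H3 Lu Cu *.
set V := v s' t' - v s t in H2 H3 Lv Cv *.
set X := F _ _ - F _ _ in H3 *.
have -> : X - (a * u1 + b * v1) * x - (a * u2 + b * v2) * y =
  (X - a * U - b * V) + a * (U - u1 * x - u2 * y) + b * (V - v1 * x - v2 * y) by ring.
have n0 : 0 <= n by rewrite addr_ge0.
have B1 : `|X - a * U - b * V| <= e / 2 * n.
  apply: (le_trans H3).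
  have -> : e / 2 * n = e / 2 / (Ku + Kv) * ((Ku + Kv) * n).
    by field; rewrite gt_eqF.
  by rewrite ler_pM2l// mulrDl lerD.
have B2 : `|a * (U - u1 * x - u2 * y)| <= `|a| * (e / 2 / A * n).
  by rewrite normrM ler_wpM2l.
have B3 : `|b * (V - v1 * x - v2 * y)| <= `|b| * (e / 2 / A * n).
  by rewrite normrM ler_wpM2l.
have B4 : `|a| * (e / 2 / A * n) + `|b| * (e / 2 / A * n) <= e / 2 * n.
  rewrite -mulrDl.
  have -> : e / 2 * n = A * (e / 2 / A * n) by field; rewrite gt_eqF.
  by apply: ler_wpM2r; [rewrite mulr_ge0// ltW|rewrite /A lerDl].
apply: (le_trans (ler_normD _ _)).
apply: (le_trans (lerD (ler_normD _ _) (lexx _))).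
move: B1 B2 B3 B4; lra.
Qed.

Lemma diff2_ext f g s t a b :
  (exists2 d : R, 0 < d & forall s' t', `|s' - s| < d -> `|t' - t| < d ->
     f s' t' = g s' t') ->
  diff2 f s t a b -> diff2 g s t a b.
Proof.
move=> [d d0 E] H e e0; have [d' d'0 Hd'] := H _ e0.
have [m m0 [m1 m2]] := small_pos d0 d'0; exists m => // s' t' h1 h2.
rewrite -!E ?subrr ?normr0//; [|exact: lt_trans m1..].
by apply: Hd'; exact: lt_trans m2.
Qed.

Lemma diff2_cst k s t : diff2 (fun _ _ => k) s t 0 0.
Proof.
move=> e e0; exists 1 => // s' t' _ _.
by rewrite !mul0r !subr0 subrr normr0 mulr_ge0 ?addr_ge0// ltW.
Qed.

Lemma diff2D f g s t a b c d : diff2 f s t a b -> diff2 g s t c d ->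
  diff2 (fun x y => f x y + g x y) s t (a + c) (b + d).
Proof.
move=> Hf Hg; have HF : diff2 (fun x y : R => x + y) (f s t) (g s t) 1 1.
  move=> e e0; exists 1 => // x y _ _.
  have -> : x + y - (f s t + g s t) - 1 * (x - f s t) - 1 * (y - g s t) = 0 by ring.
  by rewrite normr0 mulr_ge0 ?addr_ge0// ltW.
by have := diff2_comp HF Hf Hg; rewrite !mul1r.
Qed.

Lemma diff2M f g s t a b c d : diff2 f s t a b -> diff2 g s t c d ->
  diff2 (fun x y => f x y * g x y) s t (g s t * a + f s t * c) (g s t * b + f s t * d).
Proof.
move=> Hf Hg; apply: (@diff2_comp (fun x y => x * y) f g s t) => //.
move=> e e0; exists e => // x y h1 h2.
have -> : x * y - f s t * g s t - g s t * (x - f s t) - f s t * (y - g s t) =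
   (x - f s t) * (y - g s t) by ring.
rewrite normrM (le_trans (ler_wpM2r _ (ltW h1)))//.
by rewrite ler_pM2l// lerDr.
Qed.

Lemma diff2Z k f s t a b : diff2 f s t a b ->
  diff2 (fun x y => k * f x y) s t (k * a) (k * b).
Proof. by move=> H; have := diff2M (diff2_cst k s t) H; rewrite !mulr0 !add0r. Qed.

Lemma diff2N f s t a b : diff2 f s t a b -> diff2 (fun x y => - f x y) s t (- a) (- b).
Proof.
move=> /(diff2Z (-1)); rewrite !mulN1r; apply: diff2_ext.
by exists 1 => // *; rewrite mulN1r.
Qed.

Lemma diff2B f g s t a b c d : diff2 f s t a b -> diff2 g s t c d ->
  diff2 (fun x y => f x y - g x y) s t (a - c) (b - d).
Proof. by move=> Hf /diff2N Hg; exact: diff2D. Qed.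

Lemma diff2_of_partials A p q s t r : 0 < r ->
  (forall s' t', `|s' - s| < r -> `|t' - t| < r ->
     is_derive s' (1 : R) (A ^~ t') (p s' t') /\
     is_derive t' (1 : R) (A s') (q s' t')) ->
  cont2 p s t -> cont2 q s t -> diff2 A s t (p s t) (q s t).
Proof.
move=> r0 dA cp cq e e0; have [d1 d10 H1] := cp _ e0; have [d2 d20 H2] := cq _ e0.
have [m1 m10 [ma mb]] := small_pos d10 d20; have [m m0 [mc md]] := small_pos m10 r0.
exists m => // s' t' h1 h2.
have [x xs|x xs Ex] := @mvt_btw R (A ^~ t') (p ^~ t') s s'.
  have [] := dA x t' _ (lt_trans h2 md) => //.
  by rewrite (le_lt_trans (btw_sub xs))// (lt_trans h1).
have [y yt|y yt Ey] := @mvt_btw R (A s) (q s) t t'.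
  have [] := dA s y _ _ => //; first by rewrite subrr normr0.
  by rewrite (le_lt_trans (btw_sub yt))// (lt_trans h2).
have -> : A s' t' - A s t - p s t * (s' - s) - q s t * (t' - t) =
    (p x t' - p s t) * (s' - s) + (q s y - q s t) * (t' - t).
  by rewrite !mulrBl -Ex -Ey; ring.
apply: (le_trans (ler_normD _ _)); rewrite !normrM mulrDr lerD//.
  rewrite ler_wpM2r// H1//.
    by rewrite (le_lt_trans (btw_sub xs))//; lra.
  by lra.
rewrite ler_wpM2r// H2//; first by rewrite subrr normr0.
by rewrite (le_lt_trans (btw_sub yt))//; lra.
Qed.

(* Two partial derivatives of first order that are themselves differentiable at
   the point suffice (Young's form of Schwarz's theorem). *)
Lemma young f p q s t r (p1 p2 q1 q2 : R) : 0 < r ->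
  (forall s' t', `|s' - s| < r -> `|t' - t| < r ->
     is_derive s' (1 : R) (f ^~ t') (p s' t') /\
     is_derive t' (1 : R) (f s') (q s' t')) ->
  diff2 p s t p1 p2 -> diff2 q s t q1 q2 -> p2 = q1.
Proof.
move=> r0 df dp dq; apply/eqP; rewrite -subr_eq0 -normr_le0.
apply/ler_addgt0Pr => e e0; rewrite add0r.
have e8 : 0 < e / 8 by rewrite divr_gt0.
have [d1 d10 H1] := dp _ e8; have [d2 d20 H2] := dq _ e8.
have [m1 m10 [ma mb]] := small_pos d10 d20; have [m m0 [mc md]] := small_pos m10 r0.
pose h := m / 2; have h0 : 0 < h by rewrite divr_gt0.
have hm : h < m by rewrite /h; lra.
have in0 (x : R) : `|x - x| < r by rewrite subrr normr0.
have in0m (x : R) : `|x - x| < m by rewrite subrr normr0.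
have hh x' : x' + h - x' = h by rewrite addrAC subrr add0r.
have inh x : `|x + h - x| < m by rewrite hh gtr0_norm.
have inb x y : btw x (x + h) y -> `|y - x| <= h /\ `|y - x| < m.
  by move=> /btw_sub; rewrite hh (gtr0_norm h0) => H; split=> //; lra.
have mr (x : R) : x < m -> x < r by move/lt_trans; apply.
have md1 (x : R) : x < m -> x < d1 by move/lt_trans; apply; exact: lt_trans ma.
have md2 (x : R) : x < m -> x < d2 by move/lt_trans; apply; exact: lt_trans mb.
(* The second difference of [f] over a square of side [h] is expressed once by an increment of [p]
   and once by an increment of [q]. The four remainders add up to at most [6 * (e / 8) * h]. *)
have [x xs|x xs Ex] := @mvt_btw R (fun x => f x (t + h) - f x t)
    (fun x => p x (t + h) - p x t) s (s + h).
  have [_ xm] := inb _ _ xs.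
  have [D1 _] := df x _ (mr _ xm) (mr _ (inh t)).
  have [D2 _] := df x _ (mr _ xm) (in0 t).
  exact: is_deriveB.
have [y yt|y yt Ey] := @mvt_btw R (fun y => f (s + h) y - f s y)
    (fun y => q (s + h) y - q s y) t (t + h).
  have [_ ym] := inb _ _ yt.
  have [_ D1] := df _ y (mr _ (inh s)) (mr _ ym).
  have [_ D2] := df _ y (in0 s) (mr _ ym).
  exact: is_deriveB.
have [xh xm] := inb _ _ xs; have [yh ym] := inb _ _ yt.
have A1 := H1 x (t + h) (md1 _ xm) (md1 _ (inh t)).
have A2 := H1 x t (md1 _ xm) (md1 _ (in0m t)).
have B1 := H2 (s + h) y (md2 _ (inh s)) (md2 _ ym).
have B2 := H2 s y (md2 _ (in0m s)) (md2 _ ym).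
rewrite !hh in Ex Ey A1 A2 B1 B2.
rewrite !subrr !normr0 (gtr0_norm h0) in A1 A2 B1 B2.
have E : (p x (t + h) - p x t) = (q (s + h) y - q s y).
  by apply: (mulIf (lt0r_neq0 h0)); rewrite -Ex -Ey; ring.
have k1 : e / 8 * `|x - s| <= e / 8 * h by rewrite ler_pM2l.
have k2 : e / 8 * `|y - t| <= e / 8 * h by rewrite ler_pM2l.
have : `|(p2 - q1) * h| <= e * h.
  move: A1 A2 B1 B2; rewrite !ler_norml; move: E k1 k2; lra.
by rewrite normrM (gtr0_norm h0) ler_pM2r.
Qed.

(* [f1 + i f2] has complex derivative [c + i d] at [s + i t]. *)
Definition cdiff f1 f2 s t c d := diff2 f1 s t c (- d) /\ diff2 f2 s t d c.

Lemma cdiff_comp F1 F2 (h1 h2 : R -> R -> R) s t a b c d :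
  cdiff F1 F2 (h1 s t) (h2 s t) a b -> cdiff h1 h2 s t c d ->
  cdiff (fun x y => F1 (h1 x y) (h2 x y)) (fun x y => F2 (h1 x y) (h2 x y)) s t
    (a * c - b * d) (a * d + b * c).
Proof.
move=> [HF1 HF2] [H1 H2]; split.
  have := diff2_comp HF1 H1 H2; congr diff2; ring.
have := diff2_comp HF2 H1 H2; congr diff2; ring.
Qed.

Lemma cdiffB f1 f2 g1 g2 s t a b c d :
  cdiff f1 f2 s t a b -> cdiff g1 g2 s t c d ->
  cdiff (fun x y => f1 x y - g1 x y) (fun x y => f2 x y - g2 x y) s t (a - c) (b - d).
Proof.
move=> [f1' f2'] [g1' g2']; split; last exact: diff2B.
by have := diff2B f1' g1'; congr diff2; ring.
Qed.

(** By the Cauchy-Riemann equations, the real part [f1 ds - f2 dt] and the imaginary part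
    [f2 ds + f1 dt] of [f dz] are both closed. *)
Lemma cdiff_primitive f1 f2 s0 t0 r r' : 0 < r' < r ->
  (forall s t, `|s - s0| < r -> `|t - t0| < r -> exists c d, cdiff f1 f2 s t c d) ->
  exists F1 F2, forall s t, `|s - s0| < r' -> `|t - t0| < r' ->
    cdiff F1 F2 s t (f1 s t) (f2 s t).
Proof.
move=> rr H.
have [F1 H1] := @poincare R f1 f2 s0 t0 r r' rr ltac:(by
  move=> s t sr tr; have [c [d [h1 h2]]] := H s t sr tr;
  exists c, (- d), c; rewrite opprK).
have [F2 H2] := @poincare R f2 (fun s t => - f1 s t) s0 t0 r r' rr ltac:(by
  move=> s t sr tr; have [c [d [h1 h2]]] := H s t sr tr;
  exists d, c, d; split=> //; have := diff2N h1; rewrite opprK).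
exists F1, F2 => s t sr tr.
have [r0 r'r] := andP rr.
have [c [d [D1 D2]]] := H s t (lt_trans sr r'r) (lt_trans tr r'r).
pose m1 := r' - `|s - s0|; pose m2 := r' - `|t - t0|.
have m10 : 0 < m1 by rewrite subr_gt0.
have m20 : 0 < m2 by rewrite subr_gt0.
have [m m0 [mm1 mm2]] := small_pos m10 m20.
split.
  apply: (@diff2_of_partials F1 f1 (fun s t => - f2 s t) s t m) => //.
  - by move=> s' t' h1 h2; apply: H1; apply: ball_near;
      [exact: lt_trans h1 mm1|exact: lt_trans h2 mm2].
  - exact: diff2_cont2 D1.
  - exact: diff2_cont2 (diff2N D2).
apply: (@diff2_of_partials F2 f2 f1 s t m) => //.
- move=> s' t' h1 h2.
  by have := H2 s' t' (ball_near (lt_trans h1 mm1)) (ball_near (lt_trans h2 mm2)); rewrite opprK.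
- exact: diff2_cont2 D2.
- exact: diff2_cont2 D1.
Qed.

End ComplexDifferentiability.

(** * The identity principle *)

Section UniqueContinuation.
Context {R : realType}.
Implicit Types (c d s t r x y k : R).

(** The first- and second-order conditions for [u * expR w], with the exponential divided out. The
    first one turns the cross term [2 w' u'] of the second into [- 2 w'^2 u]. *)
Lemma weighted_max (u u1 w w1 : R -> R) x (u2 w2 d : R) : 0 < d ->
  (forall y, `|y - x| < d -> is_derive y (1 : R) u (u1 y)) ->
  (forall y, `|y - x| < d -> is_derive y (1 : R) w (w1 y)) ->
  is_derive x (1 : R) u1 u2 -> is_derive x (1 : R) w1 w2 ->
  (forall y, `|y - x| < d -> u y * expR (w y) <= u x * expR (w x)) ->
  u1 x = - w1 x * u x /\ u2 - w1 x ^+ 2 * u x + w2 * u x <= 0.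
Proof.
move=> d0 Du Dw Du1 Dw1 Hm.
have xx : `|x - x| < d by rewrite subrr normr0.
have := Du x xx; have := Dw x xx => dwx dux.
have := @local_max_second R (fun y => u y * expR (w y))
  (fun y => (u1 y + w1 y * u y) * expR (w y)) x
  ((u2 + (w2 * u x + w1 x * u1 x)) * expR (w x)
    + (u1 x + w1 x * u x) * (w1 x * expR (w x))) d d0.
have e0 : 0 < expR (w x) by exact: expR_gt0.
case=> //.
- move=> y yd; have := Du y yd; have := Dw y yd => dwy duy.
  have de : is_derive y (1 : R) (fun y => expR (w y)) (w1 y * expR (w y)).
    have := @is_derive1_comp R expR w y (expR (w y)) (w1 y) _ dwy.
    by rewrite mulrC; apply; exact: is_derive_expR.
  apply: (is_derive_eq (is_deriveM duy de)). rewrite /GRing.scale/= ?fctE/=; ring.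
- have de : is_derive x (1 : R) (fun y => expR (w y)) (w1 x * expR (w x)).
    have := @is_derive1_comp R expR w x (expR (w x)) (w1 x) _ dwx.
    by rewrite mulrC; apply; exact: is_derive_expR.
  have dg := is_deriveD Du1 (is_deriveM Dw1 dux).
  apply: (is_derive_eq (is_deriveM dg de)). rewrite /GRing.scale/= ?fctE/=; ring.
move=> /eqP; rewrite mulf_eq0 (gt_eqF e0) orbF => /eqP g0.
rewrite g0 mul0r addr0 pmulr_lle0// => l0.
have E : u1 x = - w1 x * u x by move: g0; lra.
split=> //; suff -> : u2 - w1 x ^+ 2 * u x + w2 * u x = u2 + (w2 * u x + w1 x * u1 x) by [].
by rewrite E; ring.
Qed.

Lemma weight_derive1 k s0 c s : (s - s0) ^+ 2 + c != 0 ->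
  is_derive s (1 : R) (fun s => k / ((s - s0) ^+ 2 + c))
    (- (2 * k * (s - s0)) / ((s - s0) ^+ 2 + c) ^+ 2).
Proof.
move=> N0.
have dN : is_derive s (1 : R) (fun s => (s - s0) ^+ 2 + c) (2 * (s - s0)).
  by apply: is_derive_eq; rewrite /GRing.scale/= ?fctE/=; ring.
by apply: (is_derive_eq (is_deriveM (is_derive_cst k s (1 : R)) (@is_deriveV R (fun s => (s - s0) ^+ 2 + c) s _ _ N0 dN))); rewrite /GRing.scale/= ?fctE/=; field.
Qed.

Lemma weight_derive2 k s0 c s : (s - s0) ^+ 2 + c != 0 ->
  is_derive s (1 : R) (fun s => - (2 * k * (s - s0)) / ((s - s0) ^+ 2 + c) ^+ 2)
    (- (2 * k) / ((s - s0) ^+ 2 + c) ^+ 2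
     + 8 * k * (s - s0) ^+ 2 / ((s - s0) ^+ 2 + c) ^+ 3).
Proof.
move=> N0.
have dN : is_derive s (1 : R) (fun s => ((s - s0) ^+ 2 + c) ^+ 2)
    (2 * ((s - s0) ^+ 2 + c) * (2 * (s - s0))).
  by apply: is_derive_eq; rewrite /GRing.scale/= ?fctE/=; ring.
have dM : is_derive s (1 : R) (fun s => - (2 * k * (s - s0))) (- (2 * k)).
  by apply: is_derive_eq; rewrite /GRing.scale/= ?fctE/=; ring.
have N2 : ((s - s0) ^+ 2 + c) ^+ 2 != 0 by rewrite expf_neq0.
by apply: (is_derive_eq (is_deriveM dM (@is_deriveV R (fun s => ((s - s0) ^+ 2 + c) ^+ 2) s _ _ N2 dN))); rewrite /GRing.scale/= ?fctE/=; field.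
Qed.

Lemma close_neq0 x y : 0 < x -> `|y - x| <= x / 2 -> y != 0.
Proof. by rewrite ler_norml => x0 h; apply/eqP => y0; lra. Qed.

(** At a critical point of [u * expR w] the gradient of [u] is [- u] times that of [w]. If [log u]
    is harmonic, the Laplacian of [u] is then [|grad w|^2 u], so adding the two second-order
    conditions leaves only the Laplacian of [w] times [u]. *)
Let add_max (a1 a2 w1 w2 r1 r2 v : R) : (w1 ^+ 2 + w2 ^+ 2) * v = a1 + a2 ->
  a1 - w1 ^+ 2 * v + r1 * v <= 0 -> a2 - w2 ^+ 2 * v + r2 * v <= 0 ->
  (r1 + r2) * v <= 0.
Proof. by move=> *; lra. Qed.

Section Disc.
Variables (s0 t0 de ro r : R) (F1 F2 f1 f2 : R -> R -> R).
Let N s t := (s - s0) ^+ 2 + (t - t0) ^+ 2.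
Hypotheses (de0 : 0 < de) (ro0 : 0 < ro) (ro_r : ro < r).
Hypothesis dF : forall s t, `|s - s0| < r -> `|t - t0| < r ->
  cdiff F1 F2 s t (f1 s t) (f2 s t).
Hypothesis df : forall s t, `|s - s0| < r -> `|t - t0| < r ->
  exists c d, cdiff f1 f2 s t c d.
Hypothesis F0 : forall s t, N s t < de ^+ 2 -> F1 s t = 0 /\ F2 s t = 0.
Let u s t := F1 s t ^+ 2 + F2 s t ^+ 2.
Let v k s t := u s t * expR (k / N s t).

Let Nle s t x : 0 <= x -> N s t <= x ^+ 2 -> `|s - s0| <= x /\ `|t - t0| <= x.
Proof.
move=> x0 H.
have sq y : y ^+ 2 <= x ^+ 2 -> `|y| <= x.
  by rewrite -[y ^+ 2]real_normK ?num_real// ler_sqr ?nnegrE.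
have := sqr_ge0 (s - s0); have := sqr_ge0 (t - t0); move: H; rewrite /N => *.
by split; apply: sq; lra.
Qed.

Let dN s t : diff2 N s t (2 * (s - s0)) (2 * (t - t0)).
Proof.
have d1 : diff2 (fun s t => s - s0) s t 1 0.
  move=> e e0; exists 1 => // s' t' _ _.
  rewrite (_ : _ - _ - _ - _ = 0) ?normr0 ?mulr_ge0 ?addr_ge0 ?(ltW e0)//; ring.
have d2 : diff2 (fun s t => t - t0) s t 0 1.
  move=> e e0; exists 1 => // s' t' _ _.
  rewrite (_ : _ - _ - _ - _ = 0) ?normr0 ?mulr_ge0 ?addr_ge0 ?(ltW e0)//; ring.
by have := diff2D (diff2M d1 d1) (diff2M d2 d2); congr diff2; ring.
Qed.

(* log (F1^2 + F2^2) is harmonic and 1 / N is strictly subharmonic, so their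
   sum has no local maximum. *)
Let no_local_max k s t d : 0 < k -> 0 < d -> 0 < N s t ->
  `|s - s0| < r -> `|t - t0| < r ->
  (forall s' t', `|s' - s| < d -> `|t' - t| < d -> v k s' t' <= v k s t) ->
  u s t <= 0.
Proof.
move=> k0 d0 Nst sr tr Hm; rewrite leNgt; apply/negP => u0.
have N0 : N s t != 0 by rewrite gt_eqF.
have [c [c' [[d11 d12] [d21 d22]]]] : exists c c',
    [/\ is_derive s (1 : R) (f1 ^~ t) c /\ is_derive t (1 : R) (f1 s) (- c') &
        is_derive s (1 : R) (f2 ^~ t) c' /\ is_derive t (1 : R) (f2 s) c].
  have [c [c' [h1 h2]]] := df sr tr; exists c, c'; split.
    by split; [exact: diff2_derive1 h1|exact: diff2_derive2 h1].
  by split; [exact: diff2_derive1 h2|exact: diff2_derive2 h2].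
have [m1 m10 [m1a m1b]] : exists2 m, 0 < m & m <= r - `|s - s0| /\ m <= r - `|t - t0|.
  have := @small_pos R (r - `|s - s0|) (r - `|t - t0|).
  by rewrite !subr_gt0 => /(_ sr tr)[m m0 [a b]]; exists m => //; split; exact: ltW.
have [e e0 HN] : exists2 e : R, 0 < e & forall s' t', `|s' - s| < e -> `|t' - t| < e -> N s' t' != 0.
  have [e e0 He] := diff2_cont2 (dN s t) (divr_gt0 Nst (ltr0n R 2)).
  by exists e => // s' t' h1 h2; apply: close_neq0 Nst _; exact: He.
have [m2 m20 [m2a m2b]] := small_pos d0 e0.
have [m m0 [ma mb]] := small_pos m10 m20.
have [ss tt] : `|s - s| < m /\ `|t - t| < m by rewrite !subrr normr0.
have du1 y : `|y - s| < m -> is_derive y (1 : R) (u ^~ t) (2 * (F1 y t * f1 y t + F2 y t * f2 y t)).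
  move=> ym; have [/diff2_derive1 h1 /diff2_derive1 h2] :=
    dF (ball_near (lt_le_trans (lt_trans ym ma) m1a)) tr.
  rewrite (_ : u ^~ t = fun y => F1 y t * F1 y t + F2 y t * F2 y t)//.
  apply: (is_derive_eq (is_deriveD (is_deriveM h1 h1) (is_deriveM h2 h2))).
  by rewrite /GRing.scale/= ?fctE/=; ring.
have du2 y : `|y - t| < m -> is_derive y (1 : R) (u s) (2 * (- (F1 s y * f2 s y) + F2 s y * f1 s y)).
  move=> ym; have [/diff2_derive2 h1 /diff2_derive2 h2] :=
     dF sr (ball_near (lt_le_trans (lt_trans ym ma) m1b)).
  rewrite (_ : u s = fun y => F1 s y * F1 s y + F2 s y * F2 s y)//.
  apply: (is_derive_eq (is_deriveD (is_deriveM h1 h1) (is_deriveM h2 h2))).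
  by rewrite /GRing.scale/= ?fctE/=; ring.
have [h11 h12] : is_derive s (1 : R) (F1 ^~ t) (f1 s t) /\ is_derive s (1 : R) (F2 ^~ t) (f2 s t).
  by have [/diff2_derive1 h1 /diff2_derive1 h2] := dF sr tr.
have [h21 h22] : is_derive t (1 : R) (F1 s) (- f2 s t) /\ is_derive t (1 : R) (F2 s) (f1 s t).
  by have [/diff2_derive2 h1 /diff2_derive2 h2] := dF sr tr.
have ddu1 : is_derive s (1 : R) (fun y => 2 * (F1 y t * f1 y t + F2 y t * f2 y t))
    (2 * (f1 s t ^+ 2 + F1 s t * c + f2 s t ^+ 2 + F2 s t * c')).
  apply: is_derive_eq; rewrite /GRing.scale/=; ring.
have ddu2 : is_derive t (1 : R) (fun y => 2 * (- (F1 s y * f2 s y) + F2 s y * f1 s y))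
    (2 * (f1 s t ^+ 2 - F1 s t * c + f2 s t ^+ 2 - F2 s t * c')).
  apply: is_derive_eq; rewrite /GRing.scale/=; ring.
have dw1 y : `|y - s| < m -> is_derive y (1 : R) (fun z => k / N z t)
    (- (2 * k * (y - s0)) / N y t ^+ 2).
  move=> ym; apply: weight_derive1; apply: HN.
    by apply: lt_trans m2b; exact: lt_trans mb.
  by rewrite subrr normr0.
have dw2 : forall y, `|y - t| < m -> is_derive y (1 : R) (fun z : R => k / ((z - t0) ^+ 2 + (s - s0) ^+ 2))
    (- (2 * k * (y - t0)) / ((y - t0) ^+ 2 + (s - s0) ^+ 2) ^+ 2).
  move=> y ym; apply: weight_derive1; rewrite addrC; apply: HN.
    by rewrite subrr normr0.
  by apply: lt_trans m2b; exact: lt_trans mb.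
have N0' : (t - t0) ^+ 2 + (s - s0) ^+ 2 != 0 by rewrite addrC.
have md x : x < m -> x < d by move=> xm; apply: lt_trans m2a; exact: lt_trans mb.
have [E1 L1] := weighted_max m0 du1 dw1 ddu1 (weight_derive2 k N0)
  (fun y ym => Hm y t (md _ ym) (md _ tt)).
have [E2 L2] := weighted_max m0 du2 dw2 ddu2 (weight_derive2 k N0')
  ltac:(move=> y ym; have := Hm s y (md _ ss) (md _ ym); rewrite /v /N ![(s - s0) ^+ 2 + _]addrC; exact).
rewrite [(t - t0) ^+ 2 + _]addrC -/(N s t) in E2 L2.
set a := F1 s t in E1 E2 L1 L2 *; set b := F2 s t in E1 E2 L1 L2 *.
set p := f1 s t in E1 E2 L1 L2 *; set q := f2 s t in E1 E2 L1 L2 *.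
set w1 := - (2 * k * (s - s0)) / _ in E1 L1; set w2 := - (2 * k * (t - t0)) / _ in E2 L2.
have uE : u s t = a ^+ 2 + b ^+ 2 by [].
(* By the Cauchy-Riemann equations [c] and [c'] drop out of the Laplacian of [u], which is
   [4 * (p ^+ 2 + q ^+ 2)], and the squared gradient is [u] times this Laplacian. *)
have grad : (w1 ^+ 2 + w2 ^+ 2) * u s t =
    2 * (p ^+ 2 + a * c + q ^+ 2 + b * c') + 2 * (p ^+ 2 - a * c + q ^+ 2 - b * c').
  apply: (mulIf (lt0r_neq0 u0)).
  have -> : (w1 ^+ 2 + w2 ^+ 2) * u s t * u s t = (- w1 * u s t) ^+ 2 + (- w2 * u s t) ^+ 2 by ring.
  by rewrite -E1 -E2 uE; ring.
have lapl : - (2 * k) / N s t ^+ 2 + 8 * k * (s - s0) ^+ 2 / N s t ^+ 3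
  + (- (2 * k) / N s t ^+ 2 + 8 * k * (t - t0) ^+ 2 / N s t ^+ 3) = 4 * k / N s t ^+ 2.
  have -> : 8 * k * (s - s0) ^+ 2 / N s t ^+ 3 = 8 * k * (N s t - (t - t0) ^+ 2) / N s t ^+ 3.
    by rewrite /N addrK.
  by field.
have : 0 < 4 * k / N s t ^+ 2 * u s t.
  by rewrite mulr_gt0// divr_gt0 ?exprn_gt0// mulr_gt0.
by rewrite -lapl ltNge (add_max grad L1 L2).
Qed.

(** On the annulus between the radii [de] and [ro], a positive maximum of [v k] can only lie on the
    outer circle, where the weight is smallest. An inner point has a strictly larger weight, so
    letting [k] grow forces [u] to vanish there. *)
Lemma disc_vanish s t : N s t < ro ^+ 2 -> F1 s t = 0 /\ F2 s t = 0.
Proof.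
move=> Nro.
have inr s' t' : N s' t' <= ro ^+ 2 -> `|s' - s0| < r /\ `|t' - t0| < r.
  by move=> /(Nle (ltW ro0))[h1 h2]; split; exact: le_lt_trans ro_r.
suff : u s t <= 0.
  rewrite /u; have := sqr_ge0 (F1 s t); have := sqr_ge0 (F2 s t) => h1 h2 h3.
  by split; apply/eqP; rewrite -sqrf_eq0 eq_le; apply/andP; split=> //; lra.
rewrite leNgt; apply/negP => u0.
have Nde : de ^+ 2 <= N s t.
  rewrite leNgt; apply/negP => /F0[h1 h2].
  by move: u0; rewrite /u h1 h2 expr0n addr0 ltxx.
pose K := [set z : R * R | de ^+ 2 <= N z.1 z.2 <= ro ^+ 2].
have K0 : K !=set0 by exists (s, t); rewrite /K/= Nde ltW.
have cN : continuous (fun z : R * R => N z.1 z.2).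
  by case=> x y; apply: cont2_continuous; exact: diff2_cont2 (dN x y).
have cK : compact K.
  apply: (@subclosed_compact _ _ (`[s0 - ro, s0 + ro] `*` `[t0 - ro, t0 + ro])).
  - have -> : K = (fun z : R * R => N z.1 z.2) @^-1` `[de ^+ 2, ro ^+ 2].
      by apply/seteqP; split=> z; rewrite /K/= in_itv.
    by apply: preimage_closed => [z _|]; [exact: cN|exact: itv_closed].
  - by apply: compact_setX; exact: segment_compact.
  move=> z /andP[_ /(Nle (ltW ro0))[]]; rewrite !ler_norml => h1 h2.
  by split; rewrite /= in_itv/=; lra.
have cu (z : R * R) : K z -> {for z, continuous (fun z : R * R => u z.1 z.2)}.
  case: z => x y /andP[_ /= /inr[h1 h2]].
  apply: (@cont2_continuous R u x y).
  have [d1 d2] := dF h1 h2.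
  exact: diff2_cont2 (diff2D (diff2M d1 d1) (diff2M d2 d2)).
have Npos (z : R * R) : K z -> 0 < N z.1 z.2.
  by move=> /andP[h _]; apply: lt_le_trans h; rewrite exprn_gt0.
have [zM zMK HM] : exists2 zM, zM \in K & forall z, z \in K -> u z.1 z.2 <= u zM.1 zM.2.
  apply: (@compact_EVT_max _ _ (fun z : R * R => u z.1 z.2)) => //.
  by apply: continuous_in_subspaceT => z; rewrite inE; exact: cu.
pose M := u zM.1 zM.2.
have M0 : 0 <= M by rewrite addr_ge0 ?sqr_ge0.
have key k : 0 < k -> v k s t <= M * expR (k / ro ^+ 2).
  move=> k0.
  have [z zK Hz] : exists2 z, z \in K & forall z', z' \in K -> v k z'.1 z'.2 <= v k z.1 z.2.
    apply: (@compact_EVT_max _ _ (fun z : R * R => v k z.1 z.2)) => //.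
    apply: continuous_in_subspaceT => z; rewrite inE => zK.
    apply: (@cvgM _ _ _ _ (fun z : R * R => u z.1 z.2) (fun z : R * R => expR (k / N z.1 z.2))); first exact: cu.
    apply: (@continuous_comp _ _ _ (fun z : R * R => k / N z.1 z.2) expR); last exact: continuous_expR.
    apply: (@cvgM _ _ _ _ (fun=> k) (fun z : R * R => (N z.1 z.2)^-1)); first exact: cvg_cst.
    by apply: cvgV; [rewrite gt_eqF// Npos|exact: cN].
  have stK : (s, t) \in K by rewrite inE /K/= Nde ltW.
  apply: (le_trans (Hz _ stK)).
  have /andP[Nz1 Nz2] : K z by rewrite -inE.
  have [zro|Nzro] := leP (ro ^+ 2) (N z.1 z.2).
    have E : N z.1 z.2 = ro ^+ 2 by apply/le_anti; rewrite Nz2.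
    rewrite /v E.
    by apply: ler_wpM2r; [exact: expR_ge0|exact: HM].
  apply: (@le_trans _ _ 0); last by rewrite mulr_ge0 ?expR_ge0.
  rewrite -[leRHS](mul0r (expR (k / N z.1 z.2))) ler_pM2r ?expR_gt0//.
  have [h1 h2] := inr _ _ Nz2.
  have cNz := cN z; have /cvgrPdist_lt/(_ (ro ^+ 2 - N z.1 z.2)) := cNz.
  rewrite subr_gt0 => /(_ Nzro)[[A B] /= [[d1 /= d10 HA] [d2 /= d20 HB]] HAB].
  have [d d0 [dd1 dd2]] := small_pos d10 d20.
  (* A maximum over [K] away from the outer circle is a local maximum in the plane, even on the
     inner circle, because [v k] vanishes inside that circle. *)
  apply: (@no_local_max k z.1 z.2 d) => //; first by apply: Npos; rewrite -inE.
  move=> s' t' hs ht.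
  have Ns' : N s' t' < ro ^+ 2.
    have As : A s' by apply: HA; rewrite /ball_/= distrC; exact: lt_trans dd1.
    have Bt : B t' by apply: HB; rewrite /ball_/= distrC; exact: lt_trans dd2.
    have /= := HAB (s', t') (conj As Bt).
    by rewrite ltr_norml; lra.
  have [deN|Nd] := leP (de ^+ 2) (N s' t').
    by apply: (Hz (s', t')); rewrite inE /K/= deN ltW.
  have [E1 E2] := F0 Nd.
  by rewrite /v {1}/u E1 E2 expr0n addr0 mul0r mulr_ge0 ?expR_ge0 ?addr_ge0 ?sqr_ge0.
have Nst : 0 < N s t by apply: lt_le_trans Nde; rewrite exprn_gt0.
pose g := (N s t)^-1 - (ro ^+ 2)^-1.
have g0 : 0 < g by rewrite subr_gt0 ltf_pV2// posrE// exprn_gt0.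
(* Since [expR (k * g) >= 1 + k * g], this [k] makes [u s t * expR (k * g)] at least
   [u s t + M + 1], which exceeds the bound [M]. *)
pose k := (M + 1) / u s t / g.
have k0 : 0 < k by rewrite !divr_gt0// ltr_wpDl.
have := key k k0; rewrite /v.
have -> : k / N s t = k * g + k / ro ^+ 2 by rewrite /g; ring.
rewrite expRD mulrA ler_pM2r ?expR_gt0// leNgt => /negP; apply.
have : M < u s t * (1 + k * g).
  have -> : u s t * (1 + k * g) = u s t + M + 1.
    by rewrite /k; field; rewrite !gt_eqF.
  by lra.
move=> /lt_le_trans; apply.
by rewrite ler_pM2l// expR_ge1Dx.
Qed.

End Disc.

End UniqueContinuation.

(** * Vanishing of complex derivatives, from an open set or from an axis *)

Section IdentityPrinciple.
Context {R : realType}.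
Implicit Types (f e : R -> R -> R) (a b c d s t r x y : R).

Lemma is_derive_unique s (l l' : R) (g : R -> R) :
  is_derive s (1 : R) g l -> is_derive s (1 : R) g l' -> l = l'.
Proof. by move=> H1 H2; rewrite -(@derive_val _ _ _ _ _ _ _ H1) derive_val. Qed.

Lemma diff2_unique f s t a b c d :
  diff2 f s t a b -> diff2 f s t c d -> a = c /\ b = d.
Proof.
move=> H1 H2; split.
  exact: is_derive_unique (diff2_derive1 H1) (diff2_derive1 H2).
exact: is_derive_unique (diff2_derive2 H1) (diff2_derive2 H2).
Qed.

Lemma diff2_locally_cst f k s t a b r : 0 < r ->
  (forall s' t', `|s' - s| < r -> `|t' - t| < r -> f s' t' = k) ->
  diff2 f s t a b -> a = 0 /\ b = 0.
Proof.
move=> r0 E H; apply: (diff2_unique H).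
by apply: diff2_ext (diff2_cst k s t); exists r => // s' t' h1 h2; rewrite E.
Qed.

Lemma cst_of_diff2_0 f a b r :
  (forall s t, `|s - a| < r -> `|t - b| < r -> diff2 f s t 0 0) ->
  forall s t, `|s - a| < r -> `|t - b| < r -> f s t = f a b.
Proof.
move=> H s t sa tb.
have r0 : 0 < r by apply: le_lt_trans sa.
have aa : `|a - a| < r by rewrite subrr normr0.
have bb : `|b - b| < r by rewrite subrr normr0.
have [x xs|x _ Ex] := @mvt_btw R (f ^~ t) (fun=> 0) a s.
  exact: diff2_derive1 (H x t (btw_ball aa sa xs) tb).
have [y yt|y _ Ey] := @mvt_btw R (f a) (fun=> 0) b t.
  exact: diff2_derive2 (H a y aa (btw_ball bb tb yt)).
rewrite !mul0r in Ex Ey; move/eqP: Ex; rewrite subr_eq0 => /eqP ->.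
by move/eqP: Ey; rewrite subr_eq0 => /eqP ->.
Qed.

Lemma dist_lt x y z (k l m : R) :
  `|x - y| < k -> `|y - z| < l -> k + l <= m -> `|x - z| < m.
Proof. by move=> h1 h2 h; have := ler_normD (x - y) (y - z); rewrite subrKA; lra. Qed.

(* Stated for the derivative [e] of a complex differentiable [f], about which
   no regularity is known beforehand. *)
Lemma derivative_identity f1 f2 e1 e2 s0 t0 r a b d : 0 < r -> 0 < d ->
  (forall s t, `|s - s0| < 8 * r -> `|t - t0| < 8 * r ->
    cdiff f1 f2 s t (e1 s t) (e2 s t)) ->
  `|a - s0| < r -> `|b - t0| < r ->
  (forall s t, `|s - a| < d -> `|t - b| < d -> e1 s t = 0 /\ e2 s t = 0) ->
  forall s t, `|s - s0| < r -> `|t - t0| < r -> e1 s t = 0 /\ e2 s t = 0.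
Proof.
move=> r0 d0 df as0 bt0 E0.
have [m m0 [md mr]] := small_pos d0 r0.
(* Radii about [(a, b)]: [7 * r] stays inside the given square, [6 * r] is left after the loss for a
   primitive, and the disc of radius [4 * r] covers the target square, whose points lie at distance
   less than [2 * sqrt 2 * r]. *)
have in8 x y : `|x - a| < 7 * r -> `|y - b| < 7 * r ->
    `|x - s0| < 8 * r /\ `|y - t0| < 8 * r.
  by move=> h1 h2; split; [apply: (dist_lt h1 as0)|apply: (dist_lt h2 bt0)]; lra.
have m7 x : x < m -> x < 7 * r by move=> xm; lra.
have m6 x : x < m -> x < 6 * r by move=> xm; lra.
have fm s t : `|s - a| < m -> `|t - b| < m -> f1 s t = f1 a b /\ f2 s t = f2 a b.
  have D s' t' : `|s' - a| < m -> `|t' - b| < m ->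
      diff2 f1 s' t' 0 0 /\ diff2 f2 s' t' 0 0.
    move=> h1 h2; have [H1 H2] := in8 _ _ (m7 _ h1) (m7 _ h2).
    have [D1 D2] := df _ _ H1 H2.
    have [z1 z2] := E0 _ _ (lt_trans h1 md) (lt_trans h2 md).
    by move: D1 D2; rewrite z1 z2 oppr0.
  move=> h1 h2; split.
    by apply: (@cst_of_diff2_0 f1 a b m) => // x y hx hy; have [] := D x y hx hy.
  by apply: (@cst_of_diff2_0 f2 a b m) => // x y hx hy; have [] := D x y hx hy.
pose g1 s t := f1 s t - f1 a b; pose g2 s t := f2 s t - f2 a b.
have dg s t : `|s - s0| < 8 * r -> `|t - t0| < 8 * r ->
    cdiff g1 g2 s t (e1 s t) (e2 s t).
  move=> h1 h2; have [D1 D2] := df s t h1 h2; split.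
    by have := diff2B D1 (diff2_cst (f1 a b) s t); rewrite !subr0.
  by have := diff2B D2 (diff2_cst (f2 a b) s t); rewrite !subr0.
(* [disc_vanish] wants a function whose derivative is again complex differentiable. Nothing of the
   kind is known of [e], so a primitive of [g] is used, with derivative [g] and second derivative
   [e]. *)
have [G1 [G2 dG]] := @cdiff_primitive R g1 g2 a b (7 * r) (6 * r) ltac:(by apply/andP; split; lra)
  ltac:(by move=> s t h1 h2; have [H1 H2] := in8 _ _ h1 h2; exists (e1 s t), (e2 s t); exact: dg).
have Gm s t : `|s - a| < m -> `|t - b| < m -> G1 s t = G1 a b /\ G2 s t = G2 a b.
  have D s' t' : `|s' - a| < m -> `|t' - b| < m ->
      diff2 G1 s' t' 0 0 /\ diff2 G2 s' t' 0 0.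
    move=> h1 h2; have [D1 D2] := dG _ _ (m6 _ h1) (m6 _ h2).
    have [z1 z2] := fm _ _ h1 h2.
    by move: D1 D2; rewrite /g1 /g2 z1 z2 !subrr oppr0.
  move=> h1 h2; split.
    by apply: (@cst_of_diff2_0 G1 a b m) => // x y hx hy; have [] := D x y hx hy.
  by apply: (@cst_of_diff2_0 G2 a b m) => // x y hx hy; have [] := D x y hx hy.
pose F1 s t := G1 s t - G1 a b; pose F2 s t := G2 s t - G2 a b.
have dF s t : `|s - a| < 6 * r -> `|t - b| < 6 * r ->
    cdiff F1 F2 s t (g1 s t) (g2 s t).
  move=> h1 h2; have [D1 D2] := dG s t h1 h2; split.
    by have := diff2B D1 (diff2_cst (G1 a b) s t); rewrite !subr0.
  by have := diff2B D2 (diff2_cst (G2 a b) s t); rewrite !subr0.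
have sq_lt x y : 0 <= y -> x ^+ 2 < y ^+ 2 -> `|x| < y.
  by move=> y0; rewrite -[x ^+ 2]real_normK ?num_real// ltr_sqr ?nnegrE.
have F0 s t : `|s - s0| < r -> `|t - t0| < r -> F1 s t = 0 /\ F2 s t = 0.
  move=> h1 h2.
  apply: (@disc_vanish R a b m (4 * r) (6 * r) F1 F2 g1 g2) => //.
  - by lra.
  - by lra.
  - move=> x y hx hy; exists (e1 x y), (e2 x y).
    have [H1 H2] : `|x - s0| < 8 * r /\ `|y - t0| < 8 * r by apply: in8; lra.
    exact: dg.
  - move=> x y; have := sqr_ge0 (x - a); have := sqr_ge0 (y - b) => x2 y2 Nm.
    have [Z1 Z2] : G1 x y = G1 a b /\ G2 x y = G2 a b.
      by apply: Gm; apply: sq_lt; rewrite ?ltW//; lra.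
    by rewrite /F1 /F2 Z1 Z2 !subrr.
  have a2 : `|s - a| < 2 * r by rewrite distrC in as0; apply: (dist_lt h1 as0); lra.
  have b2 : `|t - b| < 2 * r by rewrite distrC in bt0; apply: (dist_lt h2 bt0); lra.
  have ltsq x y : 0 <= y -> `|x| < y -> x ^+ 2 < y ^+ 2.
    by move=> y0; rewrite -[x ^+ 2]real_normK ?num_real// ltr_sqr ?nnegrE.
  have r2 : 0 <= 2 * r by lra.
  have := ltsq _ _ r2 a2; have := ltsq _ _ r2 b2.
  have -> : (4 * r) ^+ 2 = (2 * r) ^+ 2 + (2 * r) ^+ 2 + 8 * r ^+ 2 by ring.
  by have := sqr_ge0 r; lra.
have in6 s : `|s - s0| < r -> `|s - a| < 6 * r.
  by move=> h1; rewrite distrC in as0; apply: (dist_lt h1 as0); lra.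
have in6' t : `|t - t0| < r -> `|t - b| < 6 * r.
  by move=> h1; rewrite distrC in bt0; apply: (dist_lt h1 bt0); lra.
have r8 s : s < r -> s < 8 * r by move=> ?; lra.
have square f (k c c' : R) s t : (forall x y, `|x - s0| < r -> `|y - t0| < r -> f x y = k) ->
    `|s - s0| < r -> `|t - t0| < r -> diff2 f s t c c' -> c = 0 /\ c' = 0.
  move=> Hk h1 h2.
  have p1 : 0 < r - `|s - s0| by rewrite subr_gt0.
  have p2 : 0 < r - `|t - t0| by rewrite subr_gt0.
  have [n n0 [n1 n2]] := small_pos p1 p2.
  apply: (@diff2_locally_cst f k s t c c' n) => // x y hx hy.
  by apply: Hk; apply: ball_near; [exact: lt_trans n1|exact: lt_trans n2].
have g0 s t : `|s - s0| < r -> `|t - t0| < r -> g1 s t = 0 /\ g2 s t = 0.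
  move=> h1 h2; have [D1 _] := dF s t (in6 _ h1) (in6' _ h2).
  have [-> /eqP] : g1 s t = 0 /\ - g2 s t = 0.
    by apply: (square F1 0 _ _ s t) => // x y hx hy; have [] := F0 x y hx hy.
  by rewrite oppr_eq0 => /eqP ->.
move=> s t h1 h2; have [D1 _] := dg s t (r8 _ h1) (r8 _ h2).
have [-> /eqP] : e1 s t = 0 /\ - e2 s t = 0.
  by apply: (square g1 0 _ _ s t) => // x y hx hy; have [] := g0 x y hx hy.
by rewrite oppr_eq0 => /eqP ->.
Qed.

(* Cutting [f] off to [0] on one side of the axis keeps it complex
   differentiable, because there [f] is constant and [e] vanishes. *)
Lemma half_plane_identity f1 f2 e1 e2 s0 t0 r b (P : R -> bool) : 0 < r ->
  (forall s t, `|s - s0| < 8 * r -> `|t - t0| < 8 * r ->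
    cdiff f1 f2 s t (e1 s t) (e2 s t)) ->
  (forall s, `|s - s0| < 8 * r -> e1 s t0 = 0 /\ e2 s t0 = 0) ->
  (forall t t', `|t' - t| < `|t - t0| -> P t' = P t) ->
  `|b - t0| = r / 2 -> ~~ P b ->
  forall s t, `|s - s0| < r -> `|t - t0| < r -> P t -> e1 s t = 0 /\ e2 s t = 0.
Proof.
move=> r0 df E0 HP bt0 Pb.
have t08 : `|t0 - t0| < 8 * r by rewrite subrr normr0; lra.
have s08 : `|s0 - s0| < 8 * r by rewrite subrr normr0; lra.
have fax s : `|s - s0| < 8 * r -> f1 s t0 = f1 s0 t0 /\ f2 s t0 = f2 s0 t0.
  move=> h; have D x : `|x - s0| < 8 * r ->
      is_derive x (1 : R) (f1 ^~ t0) 0 /\ is_derive x (1 : R) (f2 ^~ t0) 0.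
    move=> xs; have [/diff2_derive1 D1 /diff2_derive1 D2] := df x t0 xs t08.
    by have [z1 z2] := E0 x xs; move: D1 D2; rewrite z1 z2.
  have [x xs|x _ Ex] := @mvt_btw R (f1 ^~ t0) (fun=> 0) s0 s.
    by have [] := D x (btw_ball s08 h xs).
  have [y ys|y _ Ey] := @mvt_btw R (f2 ^~ t0) (fun=> 0) s0 s.
    by have [] := D y (btw_ball s08 h ys).
  by split; apply/eqP; rewrite -subr_eq0 ?Ex ?Ey mul0r.
pose h1 s t := if P t then f1 s t - f1 s0 t0 else 0.
pose h2 s t := if P t then f2 s t - f2 s0 t0 else 0.
pose k1 s t := if P t then e1 s t else 0.
pose k2 s t := if P t then e2 s t else 0.
have cut f k s t : f s t0 = k -> diff2 f s t0 0 0 ->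
    diff2 (fun x y => if P y then f x y - k else 0) s t0 0 0.
  move=> fk H e e0; have [d d0 Hd] := H e e0; exists d => // s' t' hs ht.
  have := Hd s' t' hs ht; rewrite fk !mul0r !subr0 => Hf.
  have -> : (if P t0 then k - k else 0) = 0 :> R by rewrite subrr; case: ifP.
  rewrite subr0; case: ifP => // _.
  by rewrite normr0 mulr_ge0 ?addr_ge0// ltW.
have off f k s t a c : t != t0 -> diff2 f s t a c ->
    diff2 (fun x y => if P y then f x y - k else 0) s t
      (if P t then a else 0) (if P t then c else 0).
  move=> tt0 H; have tp : 0 < `|t - t0| by rewrite normr_gt0 subr_eq0.
  case: (boolP (P t)) => Pt.
    have := diff2B H (diff2_cst k s t); rewrite !subr0; apply: diff2_ext.
    by exists `|t - t0| => // s' t' _ /HP ->; rewrite Pt.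
  apply: diff2_ext (diff2_cst 0 s t); exists `|t - t0| => // s' t' _ /HP ->.
  by rewrite (negbTE Pt).
have dh s t : `|s - s0| < 8 * r -> `|t - t0| < 8 * r ->
    cdiff h1 h2 s t (k1 s t) (k2 s t).
  move=> hs ht; have [D1 D2] := df s t hs ht.
  have [tt|tt] := eqVneq t t0; last first.
    have := off _ (f1 s0 t0) _ _ _ _ tt D1; have := off _ (f2 s0 t0) _ _ _ _ tt D2.
    rewrite /cdiff /k1 /k2; case: (P t) => //; rewrite oppr0; exact.
  have [z1 z2] := E0 s hs; have [y1 y2] := fax s hs.
  rewrite tt z1 z2 oppr0 in D1 D2.
  rewrite /cdiff /k1 /k2 tt z1 z2 !if_same oppr0.
  by split; apply: cut.
(* The cut-off derivative vanishes on the whole side of [b], hence on the square of radius [r / 2]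
   about [(s0, b)]. *)
have K := @derivative_identity h1 h2 k1 k2 s0 t0 r s0 b (r / 2) r0 _ dh _ _ _.
have K0 s t : `|s - s0| < r -> `|t - t0| < r -> k1 s t = 0 /\ k2 s t = 0.
  apply: K; rewrite ?divr_gt0 ?subrr ?normr0 ?bt0//; first by lra.
  by move=> x y _; rewrite -bt0 => /HP Pyb; rewrite /k1 /k2 Pyb (negbTE Pb).
by move=> s t hs ht Pt; have := K0 s t hs ht; rewrite /k1 /k2 Pt.
Qed.

Lemma axis_identity f1 f2 e1 e2 s0 t0 r : 0 < r ->
  (forall s t, `|s - s0| < 8 * r -> `|t - t0| < 8 * r ->
    cdiff f1 f2 s t (e1 s t) (e2 s t)) ->
  (forall s, `|s - s0| < 8 * r -> e1 s t0 = 0 /\ e2 s t0 = 0) ->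
  forall s t, `|s - s0| < r -> `|t - t0| < r -> e1 s t = 0 /\ e2 s t = 0.
Proof.
move=> r0 df E0 s t hs ht; have r2 : 0 < r / 2 by rewrite divr_gt0.
have side t' t1 : `|t1 - t'| < `|t' - t0| -> (t0 <= t1) = (t0 <= t').
  rewrite ltr_norml; case: (ger0P (t' - t0)) => h0;
    case: (lerP t0 t') => h1; case: (lerP t0 t1) => h2 // h3; exfalso; lra.
have side' t' t1 : `|t1 - t'| < `|t' - t0| -> (t1 <= t0) = (t' <= t0).
  rewrite ltr_norml; case: (ger0P (t' - t0)) => h0;
    case: (lerP t' t0) => h1; case: (lerP t1 t0) => h2 // h3; exfalso; lra.
have [t0t|/ltW tt0] := leP t0 t.
  apply: (@half_plane_identity f1 f2 e1 e2 s0 t0 r (t0 - r / 2) (fun y => t0 <= y)) => //.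
    by rewrite addrAC subrr add0r normrN gtr0_norm.
  by rewrite -ltNge; lra.
apply: (@half_plane_identity f1 f2 e1 e2 s0 t0 r (t0 + r / 2) (fun y => y <= t0)) => //.
  by rewrite addrAC subrr add0r gtr0_norm.
by rewrite -ltNge; lra.
Qed.

End IdentityPrinciple.

(** * Gronwall's inequality *)

Section Gronwall.
Context {R : realType}.
Implicit Types (c r a x k : R).

(** To the right of [a] the product of [f] with [expR (- k * x)] does not increase; to the left the
    product with [expR (k * x)] does not decrease. Both vanish at [a], so [f <= 0] on either
    side. *)
Lemma gronwall (f g : R -> R) c r a k :
  (forall x, `|x - c| < r -> is_derive x (1 : R) f (g x)) ->
  (forall x, `|x - c| < r -> `|g x| <= k * f x) ->
  (forall x, 0 <= f x) -> `|a - c| < r -> f a = 0 ->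
  forall x, `|x - c| < r -> f x = 0.
Proof.
move=> df gf f0 ac fa x xc.
have de l y : is_derive y (1 : R) (fun y => expR (l * y)) (l * expR (l * y)).
  have dl : is_derive y (1 : R) (fun y => l * y) l.
    by apply: is_derive_eq; rewrite /GRing.scale/= mulr1.
  rewrite [X in is_derive _ _ _ X]mulrC.
  exact: (@is_derive1_comp R expR (fun y => l * y) y _ _ (is_derive_expR _) dl).
have dfe l y : `|y - c| < r ->
    is_derive y (1 : R) (fun y => f y * expR (l * y)) ((g y + l * f y) * expR (l * y)).
  move=> yc; apply: (is_derive_eq (is_deriveM (df y yc) (de l y))).
  by rewrite /GRing.scale/=; ring.
have sgn y : `|y - c| < r -> g y <= k * f y /\ 0 <= g y + k * f y.
  by move=> /gf; rewrite ler_norml => /andP[h1 h2]; split=> //; lra.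
apply/le_anti; rewrite f0 andbT.
have [ax|/ltW xa] := leP a x.
  have [y yx|y yx Ey] := @mvt_btw R (fun y => f y * expR (- k * y))
      (fun y => (g y + - k * f y) * expR (- k * y)) a x.
    by apply: dfe; exact: btw_ball ac xc yx.
  rewrite -(@pmulr_lle0 _ (expR (- k * x))) ?expR_gt0//.
  move: Ey; rewrite fa mul0r subr0 => ->.
  have [h _] := sgn y (btw_ball ac xc yx).
  rewrite mulr_le0_ge0 ?subr_ge0// mulr_le0_ge0 ?expR_ge0//.
  by rewrite mulNr subr_le0.
have [y yx|y yx Ey] := @mvt_btw R (fun y => f y * expR (k * y))
    (fun y => (g y + k * f y) * expR (k * y)) a x.
  by apply: dfe; exact: btw_ball ac xc yx.
rewrite -(@pmulr_lle0 _ (expR (k * x))) ?expR_gt0//.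
move: Ey; rewrite fa mul0r subr0 => ->.
have [_ h] := sgn y (btw_ball ac xc yx).
by rewrite mulr_ge0_le0 ?subr_le0// mulr_ge0 ?expR_ge0.
Qed.

End Gronwall.

(** * The parameter plane *)

Section Plane.
Context {R : realType}.
Implicit Types (s t r : R) (p : 'rV[R]_2).

Lemma ptK p : pt (p 0 0) (p 0 1) = p.
Proof. by apply/rowP => j; rewrite mxE; case: ifPn => [/eqP ->|] //; case: j => -[|[|]]// j _; congr (p 0 _); apply: val_inj. Qed.

Lemma open_square (O : set 'rV[R]_2) s0 t0 : open O -> O (pt s0 t0) ->
  exists2 r : R, 0 < r & forall s t, `|s - s0| < r -> `|t - t0| < r -> O (pt s t).
Proof.
move=> oO Op; have /nbhs_ballP[r /= r0 Hr] := open_nbhs_nbhs (conj oO Op).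
exists r => // s t hs ht; apply: Hr; split=> // i j; rewrite !mxE.
by case: ifP => _; rewrite /ball/= distrC.
Qed.

Lemma square_nbhs s0 t0 r (O : set 'rV[R]_2) : 0 < r ->
  (forall s t, `|s - s0| < r -> `|t - t0| < r -> O (pt s t)) -> nbhs (pt s0 t0) O.
Proof.
move=> r0 H; apply/nbhs_ballP; exists r => //= p [_ Hp]; rewrite -(ptK p).
have := Hp 0 0; have := Hp 0 1; rewrite !mxE/= /ball/= => h1 h0.
by apply: H; rewrite distrC.
Qed.

Definition vdiff (f : R -> R -> 'rV[R]_4) s t (u v : 'rV[R]_4) :=
  forall i, diff2 (fun x y => f x y 0 i) s t (u 0 i) (v 0 i).

Lemma mx_coord_le m n (M : 'M[R]_(m.+1, n.+1)) i j : `|M i j| <= `|M|.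
Proof.
by rewrite [leRHS]/Num.norm/= mx_normrE; exact: (le_bigmax _ (fun ij => `|M ij.1 ij.2|) (i, j)).
Qed.

Lemma pt_norm_le s t : `|pt s t| <= `|s| + `|t|.
Proof.
rewrite [leLHS]/Num.norm/= mx_normrE; apply: bigmax_le; first by rewrite addr_ge0.
by move=> [i j] _; rewrite mxE/=; case: ifP => _; rewrite ?lerDl ?lerDr.
Qed.

Lemma diff_bound (f : 'rV[R]_2 -> 'rV[R]_4) p : differentiable f p ->
  forall e : R, 0 < e -> exists2 d : R, 0 < d & forall h, `|h| < d ->
    `|f (h + p) - f p - 'd f p h| <= e * `|h|.
Proof.
move=> /diff_locallyxP[_ H] e e0.
have /eqaddoP/(_ e e0) : (fun h => f (h + p)) =
    (fun h => f p + 'd f p h) +o_ (nbhs (0 : 'rV[R]_2)) id by exact/funext.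
move=> /nbhs_normP[d /= d0 Hd]; exists d => // h hd.
have := Hd h; rewrite /ball_/= sub0r normrN => /(_ hd).
by rewrite [X in `|X|](_ : _ = f (h + p) - f p - 'd f p h)// !fctE opprD addrA.
Qed.

Lemma ptE s t : pt s t = s *: pt 1 0 + t *: pt 0 1 :> 'rV[R]_2.
Proof. by apply/rowP => j; rewrite !mxE; case: ifP; rewrite !(mulr0, mulr1, addr0, add0r). Qed.

Lemma differentiable_vdiff (f : 'rV[R]_2 -> 'rV[R]_4) s t : differentiable f (pt s t) ->
  vdiff (fun x y => f (pt x y)) s t (dds f (pt s t)) (ddt f (pt s t)).
Proof.
move=> df i e e0; have [d d0 Hd] := diff_bound df e0.
exists (d / 2) => [|s' t' hs ht]; first by rewrite divr_gt0.
have hn : `|pt (s' - s) (t' - t)| < d.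
  by apply: (le_lt_trans (pt_norm_le _ _)); lra.
have ptD : pt (s' - s) (t' - t) + pt s t = pt s' t' :> 'rV[R]_2.
  by apply/rowP => j; rewrite !mxE; case: ifP; rewrite subrK.
have := Hd _ hn; rewrite ptD [X in 'd f _ X]ptE linearD !linearZ/= => H.
apply: le_trans (le_trans (mx_coord_le _ 0 i) (le_trans H _)); last first.
  by rewrite ler_pM2l// pt_norm_le.
rewrite le_eqVlt; apply/orP; left; apply/eqP; congr (`|_|).
rewrite /dds /ddt !deriveE// !mxE /GRing.scale/=; ring.
Qed.

Lemma diff2_sum n (f : 'I_n -> R -> R -> R) s t (a b : 'I_n -> R) :
  (forall j, diff2 (f j) s t (a j) (b j)) ->
  diff2 (fun x y => \sum_j f j x y) s t (\sum_j a j) (\sum_j b j).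
Proof.
elim: n f a b => [|n IH] f a b H.
  rewrite !big_ord0; apply: diff2_ext (diff2_cst 0 s t).
  by exists 1 => // *; rewrite big_ord0.
rewrite !big_ord_recr/=; apply: diff2_ext (diff2D (IH _ _ _ _) (H ord_max)).
  by exists 1 => // *; rewrite big_ord_recr.
by move=> j; exact: H.
Qed.

Lemma vdiff_mulmx f s t u v (L : 'M[R]_4) : vdiff f s t u v ->
  vdiff (fun x y => f x y *m L) s t (u *m L) (v *m L).
Proof.
move=> H i; rewrite !mxE.
apply: (@diff2_ext R (fun x y => \sum_j f x y 0 j * L j i)).
  by exists 1 => // s' t' _ _; rewrite mxE.
apply: diff2_sum => j; rewrite ![_ * L j i]mulrC.
by apply: diff2_ext (diff2Z (L j i) (H j)); exists 1 => // *; rewrite mulrC.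
Qed.

(** Radii in [R[i]], normed over itself, are elements of [R[i]]; positivity makes them real. *)
Lemma complex_norm_real (e : R[i]) : 0 < e -> e = ((complex.Re e)%:C)%C /\ 0 < complex.Re e.
Proof. by case: e => a b; rewrite ltcE/= => /andP[/eqP -> ?]. Qed.

Lemma holomorphic_cdiff (U : set 'rV[R]_2) F s t : holomorphic_on U F -> U (pt s t) ->
  exists c d, cdiff (fun x y => F (pt x y) 0 0) (fun x y => F (pt x y) 0 1) s t c d.
Proof.
move=> /(_ (pt s t)) H /H; rewrite /derivable.
set g := (fun h : R[i]^o => _) => /cvg_ex[/= c gc].
have key (e : R) : 0 < e -> exists2 d : R, 0 < d & forall s' t', `|s' - s| < d -> `|t' - t| < d ->
    `|cplx (F (pt s' t')) - cplx (F (pt s t)) - c * ((s' - s) +i* (t' - t))%C|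
    <= (e * (`|s' - s| + `|t' - t|))%:C%C.
  move=> e0; have e0' : 0 < (e%:C)%C :> R[i] by rewrite ltcR.
  move/cvgrPdist_le : gc => /(_ _ e0')[d /= d0 Hd].
  have [dE d0'] := complex_norm_real d0.
  exists (complex.Re d / 2) => [|s' t' hs ht]; first by rewrite divr_gt0.
  pose z : R[i] := ((s' - s) +i* (t' - t))%C.
  have zn : `|z| <= (`|s' - s| + `|t' - t|)%:C%C.
    have nn : 0 <= `|s' - s| + `|t' - t| by rewrite addr_ge0.
    rewrite normc_def/= lecR -(ger0_norm nn) -sqrtr_sqr ler_wsqrtr//.
    rewrite -[(s' - s) ^+ 2]real_normK ?num_real// -[(t' - t) ^+ 2]real_normK ?num_real//.
    by rewrite [leRHS]sqrrD addrAC lerDl mulrn_wge0// mulr_ge0.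
  (* The limit defining the derivative is punctured, so the zero increment is treated apart. *)
  have [z0|z0] := eqVneq z 0.
    move: (z0) => /eqP; rewrite eq_complex/= => /andP[/eqP h1 /eqP h2].
    move: h1 h2 => /eqP; rewrite subr_eq0 => /eqP -> /eqP; rewrite subr_eq0 => /eqP ->.
    by rewrite !subrr normr0 addr0 mulr0 sub0r -/(0 : R[i]) mulr0 oppr0 normr0.
  have zd : `|0 - z| < d.
    rewrite sub0r normrN dE; apply: (le_lt_trans zn); rewrite ltcR; lra.
  have := Hd z zd z0; rewrite /g.
  have -> : z *: (1 : R[i]^o) + cplx (pt s t) = cplx (pt s' t').
    by rewrite /GRing.scale/= mulr1 /cplx !mxE/= /z; simpc; rewrite !subrK.
  have pl (x y : R) : plane (cplx (pt x y)) = pt x y by rewrite /plane /cplx !mxE.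
  rewrite !pl /GRing.scale/= => He.
  have -> : cplx (F (pt s' t')) - cplx (F (pt s t)) - c * z =
    - (c - z^-1 * (cplx (F (pt s' t')) - cplx (F (pt s t)))) * z by field.
  rewrite normrM normrN rmorphM/=; apply: ler_pM => //.
exists (complex.Re c), (complex.Im c); split=> e e0; have [d d0 Hd] := key e e0;
  exists d => // s' t' hs ht; have := Hd s' t' hs ht.
  set w := (X in `|X|) => Hw.
  have : (`|complex.Re w|%:C)%C <= (e * (`|s' - s| + `|t' - t|))%:C%C.
    by apply: le_trans Hw; exact: normc_ge_Re.
  rewrite lecR; apply: le_trans; rewrite le_eqVlt; apply/orP; left; apply/eqP; congr (`|_|).
  by rewrite /w /cplx; case: c @w {gc key Hd Hw} => c1 c2 /=; ring.
set w := (X in `|X|) => Hw.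
have : (`|complex.Im w|%:C)%C <= (e * (`|s' - s| + `|t' - t|))%:C%C.
  by apply: le_trans Hw; rewrite normc_def lecR -sqrtr_sqr ler_wsqrtr// lerDr sqr_ge0.
rewrite lecR; apply: le_trans; rewrite le_eqVlt; apply/orP; left; apply/eqP; congr (`|_|).
by rewrite /w /cplx; case: c @w {gc key Hd Hw} => c1 c2 /=; ring.
Qed.

End Plane.

(** * Bryant's equation *)

Section LorentzCoordinates.
Context {R : realType}.
Implicit Types (u v w x a b : 'rV[R]_4).

Definition o0 : 'I_4 := Ordinal (isT : (0 < 4)%N).
Definition o1 : 'I_4 := Ordinal (isT : (1 < 4)%N).
Definition o2 : 'I_4 := Ordinal (isT : (2 < 4)%N).
Definition o3 : 'I_4 := Ordinal (isT : (3 < 4)%N).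

Lemma forall_ord4 (P : 'I_4 -> Prop) : P o0 -> P o1 -> P o2 -> P o3 -> forall i, P i.
Proof.
move=> p0 p1 p2 p3 [[|[|[|[|]]]] lt] //.
- by rewrite (_ : Ordinal lt = o0)//; exact: val_inj.
- by rewrite (_ : Ordinal lt = o1)//; exact: val_inj.
- by rewrite (_ : Ordinal lt = o2)//; exact: val_inj.
- by rewrite (_ : Ordinal lt = o3)//; exact: val_inj.
Qed.

Lemma sum_ord4 (E : zmodType) (F : 'I_4 -> E) : \sum_i F i = F o0 + F o1 + F o2 + F o3.
Proof.
rewrite !big_ord_recl big_ord0 addr0 !addrA.
by congr (F _ + F _ + F _ + F _); exact: val_inj.
Qed.

Lemma lorE u v :
  lor u v = - (u 0 o0 * v 0 o0) + u 0 o1 * v 0 o1 + u 0 o2 * v 0 o2 + u 0 o3 * v 0 o3.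
Proof. by rewrite /lor sum_ord4 /= mulN1r !mul1r mulNr. Qed.

Definition det3 (a1 a2 a3 b1 b2 b3 c1 c2 c3 : R) :=
  a1 * (b2 * c3 - b3 * c2) - a2 * (b1 * c3 - b3 * c1) + a3 * (b1 * c2 - b2 * c1).

Lemma det_mx3 (N : nat -> nat -> R) :
  \det (\matrix_(i < 3, j < 3) N i j) =
  det3 (N 0 0) (N 0 1) (N 0 2) (N 1 0) (N 1 1) (N 1 2) (N 2 0) (N 2 1) (N 2 2)%N.
Proof.
rewrite (expand_det_row _ ord0) !big_ord_recl big_ord0 addr0.
rewrite /cofactor !(expand_det_row _ ord0) !big_ord_recl !big_ord0 !addr0.
rewrite /cofactor !det_mx11 !mxE /det3 /= /bump /=.
by rewrite !(addn0, add0n, expr0, expr1, exprS) /=; ring.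
Qed.

Lemma crossE u v w :
  [/\ cross u v w 0 o0 = det3 (u 0 o1) (u 0 o2) (u 0 o3) (v 0 o1) (v 0 o2) (v 0 o3)
                              (w 0 o1) (w 0 o2) (w 0 o3),
      cross u v w 0 o1 = det3 (u 0 o0) (u 0 o2) (u 0 o3) (v 0 o0) (v 0 o2) (v 0 o3)
                              (w 0 o0) (w 0 o2) (w 0 o3),
      cross u v w 0 o2 = - det3 (u 0 o0) (u 0 o1) (u 0 o3) (v 0 o0) (v 0 o1) (v 0 o3)
                              (w 0 o0) (w 0 o1) (w 0 o3)
    & cross u v w 0 o3 = det3 (u 0 o0) (u 0 o1) (u 0 o2) (v 0 o0) (v 0 o1) (v 0 o2)
                              (w 0 o0) (w 0 o1) (w 0 o2)].
Proof.
have D (i : 'I_4) : det4 u v w (delta_mx 0 i) =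
    (-1) ^+ (3 + i) * \det (\matrix_(k < 3, l < 3) [:: u; v; w]`_k 0 (inord (bump i l))).
  rewrite /det4 (expand_det_row _ o3) (bigD1 i)//= big1 ?addr0 => [|j ji].
    rewrite !mxE !eqxx mul1r /cofactor; congr (_ * \det _).
    apply/matrixP => k l; rewrite !mxE; case: k => -[|[|[|]]]//= k3;
      by congr (_ 0 _); apply: val_inj; rewrite /= inordK//; exact: (ltn_ord (lift i l)).
  by rewrite !mxE /= (negPf ji) ?andbF mul0r.
have I (k : 'I_4) : inord k = k :> 'I_4 by exact: inord_val.
have I0 := I o0; have I1 := I o1; have I2 := I o2; have I3 := I o3.
have J i := @det_mx3 (fun k l => [:: u; v; w]`_k 0 (inord (bump i l))).
rewrite /cross !mxE !D !J /bump /= in I0 I1 I2 I3 *.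
by rewrite !(addn0, add0n) /= I0 I1 I2 I3 /det3; split; ring.
Qed.

End LorentzCoordinates.

(** * Algebra of the form and of the Lorentzian cross product *)

Section BryantForm.
Context {R : realType}.
Implicit Types (u v w x h y a b A M C : 'rV[R]_4) (j k l : 'I_4).

(** The cyclic orders of the spatial indices: each identity is stated once for all three Pauli
    components. *)
Definition cyclic3 j k l :=
  [\/ [/\ j = o1, k = o2 & l = o3], [/\ j = o2, k = o3 & l = o1]
    | [/\ j = o3, k = o1 & l = o2]].

(* In the Hermitian model of Minkowski space, let [X] be the matrix of [x] and
   [dX] that of [a - i b] (twice the z-derivative of [x]).  The traceless matrix
   [dX X^-1] has three complex coordinates on the Pauli matrices, whose real and
   imaginary parts are the following.  Bryant's equation for [x] amounts to this
   matrix being holomorphic. *)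
Definition formRe j k l x a b : R :=
  x 0 o0 * a 0 j - x 0 j * a 0 o0 + (b 0 k * x 0 l - b 0 l * x 0 k).

Definition formIm j k l x a b : R :=
  - (x 0 o0 * b 0 j - x 0 j * b 0 o0) + (a 0 k * x 0 l - a 0 l * x 0 k).

(** The chain rule for a map with complex derivative [c + i d] multiplies [a - i b] by that number;
    the form is complex linear in [a - i b]. *)
Lemma form_rotate j k l x a b (c d : R) :
  formRe j k l x (c *: a + d *: b) (- d *: a + c *: b) =
    formRe j k l x a b * c - formIm j k l x a b * d /\
  formIm j k l x (c *: a + d *: b) (- d *: a + c *: b) =
    formRe j k l x a b * d + formIm j k l x a b * c.
Proof. by rewrite /formRe /formIm !mxE; split; ring. Qed.

(** For [a] orthogonal to [x] and [h], the bivector of [a] and [cross x h a] is, up to sign,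
    [lor a a] times the Hodge dual of the bivector of [x] and [h]. *)
Lemma cross_wedge j k l x h a : cyclic3 j k l -> lor x a = 0 -> lor h a = 0 ->
  a 0 k * cross x h a 0 l - a 0 l * cross x h a 0 k =
    lor a a * (x 0 o0 * h 0 j - x 0 j * h 0 o0) /\
  a 0 o0 * cross x h a 0 j - a 0 j * cross x h a 0 o0 =
    lor a a * (h 0 k * x 0 l - h 0 l * x 0 k).
Proof.
move=> cyc xa ha.
(* Multiples of the vanishing products [lor x a] and [lor h a] are added so that both equalities
   become polynomial identities in arbitrary vectors. *)
have -> : lor a a * (x 0 o0 * h 0 j - x 0 j * h 0 o0) =
    lor a a * (x 0 o0 * h 0 j - x 0 j * h 0 o0)
    - lor x a * (a 0 o0 * h 0 j - a 0 j * h 0 o0)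
    - lor h a * (x 0 o0 * a 0 j - x 0 j * a 0 o0).
  by rewrite xa ha; ring.
have -> : lor a a * (h 0 k * x 0 l - h 0 l * x 0 k) =
    lor a a * (h 0 k * x 0 l - h 0 l * x 0 k)
    - lor x a * (h 0 k * a 0 l - h 0 l * a 0 k)
    - lor h a * (a 0 k * x 0 l - a 0 l * x 0 k).
  by rewrite xa ha; ring.
have [c0 c1 c2 c3] := crossE x h a.
rewrite !lorE.
by case: cyc => -[-> -> ->]; rewrite c0 ?c1 ?c2 ?c3 /det3; split; ring.
Qed.

(** Using the same [M] for both mixed derivatives makes it cancel, so that second derivatives enter
    only through [A + C]. Its [x] part has no bivector with [x], and its [h] part is balanced,
    through [cross_wedge], by the terms quadratic in the first derivatives. *)
Lemma form_cauchy_riemann j k l x h a b A M C : cyclic3 j k l ->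
  lor x a = 0 -> lor h a = 0 -> b = cross x h a ->
  A + C = (2 * lor a a) *: (x + h) ->
  formRe j k l a a b + formRe j k l x A M = formIm j k l b a b + formIm j k l x M C /\
  formRe j k l b a b + formRe j k l x M C = - (formIm j k l a a b + formIm j k l x A M).
Proof.
move=> cyc xa ha bE AC.
have AE i : A 0 i = 2 * lor a a * (x 0 i + h 0 i) - C 0 i.
  by move/rowP/(_ i): AC; rewrite !mxE => <-; rewrite addrK.
have [] := cross_wedge cyc xa ha; rewrite -bE => w1 w2.
rewrite /formRe /formIm !AE; split.
  apply/eqP; rewrite -subr_eq0; apply/eqP.
  transitivity (2 * (lor a a * (x 0 o0 * h 0 j - x 0 j * h 0 o0)
                     - (a 0 k * b 0 l - a 0 l * b 0 k))); first by ring.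
  by rewrite w1 subrr mulr0.
apply/eqP; rewrite -subr_eq0; apply/eqP.
transitivity (2 * (lor a a * (h 0 k * x 0 l - h 0 l * x 0 k)
                   - (a 0 o0 * b 0 j - a 0 j * b 0 o0))); first by ring.
by rewrite w2 subrr mulr0.
Qed.

(* [dX = (dX X^-1) X]. *)
Lemma form_reconstruct j k l x a b : cyclic3 j k l -> lor x x = -1 ->
  lor x a = 0 -> lor x b = 0 ->
  let P i := if i == o1 then formRe o1 o2 o3 x a b
        else if i == o2 then formRe o2 o3 o1 x a b else formRe o3 o1 o2 x a b in
  let Q i := if i == o1 then formIm o1 o2 o3 x a b
        else if i == o2 then formIm o2 o3 o1 x a b else formIm o3 o1 o2 x a b in
  [/\ a 0 o0 = P o1 * x 0 o1 + P o2 * x 0 o2 + P o3 * x 0 o3,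
      a 0 j = x 0 o0 * P j + (Q k * x 0 l - Q l * x 0 k),
      b 0 o0 = - (Q o1 * x 0 o1 + Q o2 * x 0 o2 + Q o3 * x 0 o3)
    & b 0 j = - x 0 o0 * Q j + (P k * x 0 l - P l * x 0 k)].
Proof.
move=> cyc xx xa xb P Q.
(* The factor [- lor x x], which is 1, homogenizes the four equations; with multiples of [lor x a]
   and [lor x b] added they hold for arbitrary vectors. *)
have n v i : v 0 i = - lor x x * v 0 i by rewrite xx opprK mul1r.
have na i : - lor x x * a 0 i = x 0 i * lor x a - lor x x * a 0 i.
  by rewrite xa mulr0 sub0r mulNr.
have nb i : - lor x x * b 0 i = x 0 i * lor x b - lor x x * b 0 i.
  by rewrite xb mulr0 sub0r mulNr.
rewrite (n a) na (n a j) na (n b) nb (n b j) nb !lorE /P /Q.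
by case: cyc => -[-> -> ->] /=; rewrite /formRe /formIm; split; ring.
Qed.

Lemma lorC u v : lor u v = lor v u.
Proof. by rewrite !lorE; ring. Qed.

Lemma lorDl u v w : lor (u + v) w = lor u w + lor v w.
Proof. by rewrite !lorE !mxE; ring. Qed.

Lemma lorZl (c : R) u w : lor (c *: u) w = c * lor u w.
Proof. by rewrite !lorE !mxE; ring. Qed.

Lemma lor_nondegenerate u v w a y : det4 u v w a != 0 ->
  lor y u = 0 -> lor y v = 0 -> lor y w = 0 -> lor y a = 0 -> y = 0.
Proof.
move=> d0 yu yv yw ya.
pose P : 'M[R]_4 := \matrix_(i < 4) [:: u; v; w; a]`_i.
pose z : 'cV[R]_4 := \col_i ((if i == 0 then -1 else 1) * y 0 i).
have Pu : P \in unitmx by rewrite unitmxE unitfE.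
have Pz : P *m z = 0.
  apply/colP => i; rewrite !mxE.
  transitivity (lor y ([:: u; v; w; a]`_i)).
    by apply: eq_bigr => j _; rewrite !mxE mulrC.
  by move: i; apply: forall_ord4.
have z0 : z = 0 by rewrite -[z](mulKmx Pu) Pz mulmx0.
apply/rowP => i; have /colP/(_ i) := z0; rewrite !mxE.
by case: ifP => _ /eqP; rewrite mulf_eq0 ?oppr_eq0 oner_eq0 => /eqP.
Qed.

Lemma tangent_spacelike x a : lor x x = -1 -> lor x a = 0 -> lor a a = 0 -> a = 0.
Proof.
rewrite !lorE => xx xa aa.
set x0 := x 0 o0 in xx xa; set x1 := x 0 o1 in xx xa; set x2 := x 0 o2 in xx xa.
set x3 := x 0 o3 in xx xa; set a0 := a 0 o0 in xa aa; set a1 := a 0 o1 in xa aa.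
set a2 := a 0 o2 in xa aa; set a3 := a 0 o3 in xa aa.
(* Lagrange's identity for the spatial parts *)
have L : a0 ^+ 2 = - ((x1 * a2 - x2 * a1) ^+ 2 + (x2 * a3 - x3 * a2) ^+ 2
                      + (x3 * a1 - x1 * a3) ^+ 2).
  have E1 : x1 * a1 + x2 * a2 + x3 * a3 = x0 * a0 by lra.
  have E2 : x1 ^+ 2 + x2 ^+ 2 + x3 ^+ 2 = x0 ^+ 2 - 1 by lra.
  have E3 : a1 ^+ 2 + a2 ^+ 2 + a3 ^+ 2 = a0 ^+ 2 by lra.
  transitivity ((x1 * a1 + x2 * a2 + x3 * a3) ^+ 2
     - (x1 ^+ 2 + x2 ^+ 2 + x3 ^+ 2) * (a1 ^+ 2 + a2 ^+ 2 + a3 ^+ 2)); last by ring.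
  by rewrite E1 E2 E3; ring.
have a00 : a0 = 0.
  apply/eqP; rewrite -sqrf_eq0 eq_le sqr_ge0 andbT L oppr_le0.
  by rewrite !addr_ge0 ?sqr_ge0.
have h1 := sqr_ge0 a1; have h2 := sqr_ge0 a2; have h3 := sqr_ge0 a3.
have aa' : a1 ^+ 2 + a2 ^+ 2 + a3 ^+ 2 = 0.
  by move: aa; rewrite a00; lra.
have z (c : R) : c ^+ 2 = 0 -> c = 0 by move/eqP; rewrite sqrf_eq0 => /eqP.
by apply/rowP; apply: forall_ord4; rewrite mxE//; apply: z;
  rewrite -/a1 -/a2 -/a3; lra.
Qed.

(** Paired with any vector, both sides are determinants, which agree because [\det L = 1];
    nondegeneracy of the metric concludes. *)
Lemma cross_mulmx (L : 'M[R]_4) u v w : (forall u v, lor (u *m L) (v *m L) = lor u v) ->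
  \det L = 1 -> cross (u *m L) (v *m L) (w *m L) = cross u v w *m L.
Proof.
move=> Liso detL.
have Lu : L \in unitmx by rewrite unitmxE detL unitr1.
have dL a : det4 (u *m L) (v *m L) (w *m L) (a *m L) = det4 u v w a.
  rewrite /det4 -[RHS]mulr1 -detL -det_mulmx; congr (\det _).
  apply/row_matrixP; apply: forall_ord4; rewrite row_mul !rowK //.
have E a : lor (cross (u *m L) (v *m L) (w *m L) - cross u v w *m L) a = 0.
  rewrite -[a](mulmxKV Lu) -[- _]scaleN1r lorDl lorZl lor_cross dL Liso lor_cross.
  by rewrite mulN1r subrr.
apply/eqP; rewrite -subr_eq0; apply/eqP.
have e1 (i : 'I_4) : (delta_mx 0 i : 'rV[R]_4) = row i 1%:M by rewrite rowE mulmx1.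
apply: (@lor_nondegenerate (delta_mx 0 o0) (delta_mx 0 o1) (delta_mx 0 o2) (delta_mx 0 o3)) => //.
rewrite /det4 (_ : \matrix_(i < 4) _ = 1%:M) ?det1 ?oner_eq0//.
by apply/row_matrixP; apply: forall_ord4; rewrite rowK/= e1.
Qed.

End BryantForm.

(** * From mean curvature 1 to the equation for the Laplacian *)

Section BryantEquation.
Context {R : realType}.
Implicit Types (s t r : R) (f g : R -> R -> 'rV[R]_4) (u v : 'rV[R]_4).

Lemma vdiff_lor f g s t u v u' v' : vdiff f s t u v -> vdiff g s t u' v' ->
  diff2 (fun x y => lor (f x y) (g x y)) s t
    (lor u (g s t) + lor (f s t) u') (lor v (g s t) + lor (f s t) v').
Proof.
move=> Hf Hg; have dM i := diff2M (Hf i) (Hg i).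
have := diff2D (diff2D (diff2D (diff2N (dM o0)) (dM o1)) (dM o2)) (dM o3).
rewrite (_ : (fun x y => lor (f x y) (g x y)) = fun x y =>
  - (f x y 0 o0 * g x y 0 o0) + f x y 0 o1 * g x y 0 o1
  + f x y 0 o2 * g x y 0 o2 + f x y 0 o3 * g x y 0 o3).
  by congr diff2; rewrite !lorE; ring.
by apply/funext => x; apply/funext => y; rewrite lorE.
Qed.

Lemma formRe_diff j k l x a b s t (a0 b0 A M M' C : 'rV[R]_4) :
  vdiff x s t a0 b0 -> vdiff a s t A M -> vdiff b s t M' C ->
  diff2 (fun y z => formRe j k l (x y z) (a y z) (b y z)) s t
    (formRe j k l a0 (a s t) (b s t) + formRe j k l (x s t) A M')
    (formRe j k l b0 (a s t) (b s t) + formRe j k l (x s t) M C).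
Proof.
move=> dx da db.
have P (f g : R -> R -> 'rV[R]_4) i i' u v u' v' (hf : vdiff f s t u v) (hg : vdiff g s t u' v') :=
  diff2B (diff2M (hf i) (hg i')) (diff2M (hf i') (hg i)).
have Q := diff2D (P _ _ o0 j _ _ _ _ dx da) (P _ _ k l _ _ _ _ db dx).
by move: Q; rewrite /formRe; congr diff2; ring.
Qed.

Lemma formIm_diff j k l x a b s t (a0 b0 A M M' C : 'rV[R]_4) :
  vdiff x s t a0 b0 -> vdiff a s t A M -> vdiff b s t M' C ->
  diff2 (fun y z => formIm j k l (x y z) (a y z) (b y z)) s t
    (formIm j k l a0 (a s t) (b s t) + formIm j k l (x s t) A M')
    (formIm j k l b0 (a s t) (b s t) + formIm j k l (x s t) M C).
Proof.
move=> dx da db.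
have P (f g : R -> R -> 'rV[R]_4) i i' u v u' v' (hf : vdiff f s t u v) (hg : vdiff g s t u' v') :=
  diff2B (diff2M (hf i) (hg i')) (diff2M (hf i') (hg i)).
have Q := diff2D (diff2N (P _ _ o0 j _ _ _ _ dx db)) (P _ _ k l _ _ _ _ da dx).
by move: Q; rewrite /formIm; congr diff2; ring.
Qed.

(** [A] and [C] are the pure second derivatives. A conformal immersion in the hyperboloid with mean
    curvature [H] has Laplacian [2 * lor a a] times [x + H h]; [jet_laplace] is the case [H = 1]. *)
Record bryant_jet (x h a b A C : 'rV[R]_4) : Prop := BryantJet {
  jet_hyp : lor x x = -1 ;
  jet_xa : lor x a = 0 ;
  jet_xb : lor x b = 0 ;
  jet_ha : lor h a = 0 ;
  jet_cross : b = cross x h a ;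
  jet_laplace : A + C = (2 * lor a a) *: (x + h) }.

Lemma bryant_jet_mulmx x h a b A C (L : 'M[R]_4) :
  (forall u v, lor (u *m L) (v *m L) = lor u v) -> \det L = 1 ->
  bryant_jet x h a b A C ->
  bryant_jet (x *m L) (h *m L) (a *m L) (b *m L) (A *m L) (C *m L).
Proof.
move=> Liso detL [h1 h2 h3 h4 h5 h6]; split; rewrite ?Liso//.
  by rewrite h5 cross_mulmx.
by rewrite -!mulmxDl h6 scalemxAl.
Qed.

Lemma lorDr u v w : lor u (v + w) = lor u v + lor u w.
Proof. by rewrite !lorE !mxE; ring. Qed.

Lemma lorZr (c : R) u v : lor u (c *: v) = c * lor u v.
Proof. by rewrite !lorE !mxE; ring. Qed.

Lemma lorNr u v : lor u (- v) = - lor u v.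
Proof. by rewrite !lorE !mxE; ring. Qed.

(** Differentiating the constraints gives the products of [A + C] with the frame [x], [h], [a], [b].
    The trace of the shape operator appears in the product with [h], and the products with [a] and
    [b] vanish by conformality. *)
Lemma jet_of_equations (D : R -> R -> Prop) (x h a b : R -> R -> 'rV[R]_4) s t
    (h1 h2 A M C : 'rV[R]_4) (S11 S12 S21 S22 : R) :
  (forall s t, D s t -> exists2 r : R, 0 < r &
     forall y z, `|y - s| < r -> `|z - t| < r -> D y z) ->
  (forall y z, D y z -> vdiff x y z (a y z) (b y z)) ->
  (forall y z, D y z -> lor (x y z) (x y z) = -1) ->
  (forall y z, D y z -> lor (h y z) (x y z) = 0) ->
  (forall y z, D y z -> lor (h y z) (h y z) = 1) ->
  (forall y z, D y z -> lor (h y z) (a y z) = 0 /\ lor (h y z) (b y z) = 0) ->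
  (forall y z, D y z -> lor (a y z) (a y z) = lor (b y z) (b y z) /\
     lor (a y z) (b y z) = 0) ->
  D s t -> b s t = cross (x s t) (h s t) (a s t) -> a s t != 0 ->
  vdiff h s t h1 h2 -> vdiff a s t A M -> vdiff b s t M C ->
  h1 = - (S11 *: a s t + S12 *: b s t) -> h2 = - (S21 *: a s t + S22 *: b s t) ->
  S11 + S22 = 2 ->
  bryant_jet (x s t) (h s t) (a s t) (b s t) A C.
Proof.
move=> oD dx Hxx Hhx Hhh Hn Hc Dst bE a_neq0 dh da db h1E h2E trS.
have zero y z f g k u v u' v' : D y z -> vdiff f y z u v -> vdiff g y z u' v' ->
    (forall y z, D y z -> lor (f y z) (g y z) = k) ->
    lor u (g y z) + lor (f y z) u' = 0 /\ lor v (g y z) + lor (f y z) v' = 0.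
  move=> Dyz hf hg hk; have [q q0 Dq] := oD _ _ Dyz.
  apply: (diff2_locally_cst q0 _ (vdiff_lor hf hg)).
  by move=> y' z' hy hz; apply: hk; exact: Dq.
have tan y z : D y z -> lor (a y z) (x y z) = 0 /\ lor (b y z) (x y z) = 0.
  move=> Dyz; have := zero _ _ _ _ _ _ _ _ _ Dyz (dx _ _ Dyz) (dx _ _ Dyz) Hxx.
  by rewrite ![lor (x _ _) _]lorC => -[e1 e2]; split; lra.
have [ax bx] := tan _ _ Dst; have [ha hb] := Hn _ _ Dst; have [aabb ab] := Hc _ _ Dst.
have xx := Hxx _ _ Dst; have hh := Hhh _ _ Dst; have hx := Hhx _ _ Dst.
have dx0 := dx _ _ Dst.
have [Ax _] := zero _ _ _ _ _ _ _ _ _ Dst da dx0 (fun y z h => (tan y z h).1).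
have [_ Cx] := zero _ _ _ _ _ _ _ _ _ Dst db dx0 (fun y z h => (tan y z h).2).
have [Ah _] := zero _ _ _ _ _ _ _ _ _ Dst dh da (fun y z h => (Hn y z h).1).
have [_ Ch] := zero _ _ _ _ _ _ _ _ _ Dst dh db (fun y z h => (Hn y z h).2).
have [Ab Mb] := zero _ _ _ _ _ _ _ _ _ Dst da db (fun y z h => (Hc y z h).2).
have [AM MC] : lor A (a s t) = lor M (b s t) /\ lor M (a s t) = lor C (b s t).
  have [r r0 Dr] := oD _ _ Dst.
  have := diff2_locally_cst (k := 0) r0 _ (diff2B (vdiff_lor da da) (vdiff_lor db db)).
  case=> [y z hy hz|]; first by have [-> _] := Hc _ _ (Dr _ _ hy hz); rewrite subrr.
  by rewrite ![lor (a _ _) _]lorC ![lor (b _ _) _]lorC => e1 e2; split; lra.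
move: (x s t) (h s t) (a s t) (b s t) h1E h2E a_neq0 bE
  ax bx ha hb aabb ab xx hh hx Ax Cx Ah Ch Ab Mb AM MC => X H a0 b0.
move=> -> -> a_neq0 bE ax bx ha hb aabb ab xx hh hx Ax Cx Ah Ch Ab Mb AM MC.
have ba : lor b0 a0 = 0 by rewrite lorC.
rewrite lorC lorNr lorDr !lorZr ab in Ah; rewrite lorC lorNr lorDr !lorZr ba in Ch.
(* The frame is a basis: its determinant is [lor b0 b0 = lor a0 a0], nonzero because tangent vectors
   are spacelike. *)
have lam : det4 X H a0 b0 != 0.
  rewrite -lor_cross -bE -aabb; apply/eqP => aa0.
  by move/eqP: a_neq0; apply; apply: (tangent_spacelike xx) => //; rewrite lorC.
have Y : A + C - (2 * lor a0 a0) *: (X + H) = 0.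
  have e u : lor (A + C - (2 * lor a0 a0) *: (X + H)) u =
      lor A u + lor C u - 2 * lor a0 a0 * (lor X u + lor H u).
    by rewrite !lorE !mxE; ring.
  have xh : lor X H = 0 by rewrite lorC.
  have xa : lor X a0 = 0 by rewrite lorC.
  have xb : lor X b0 = 0 by rewrite lorC.
  apply: (lor_nondegenerate lam); rewrite e.
  - by rewrite xx hx; move: Ax Cx; rewrite aabb; clear; lra.
  - rewrite hh xh; move: Ah Ch; rewrite aabb ![lor H _]lorC -trS; clear; lra.
  - by rewrite xa ha; move: AM Mb; rewrite [lor a0 C]lorC; clear; lra.
  - by rewrite xb hb; move: MC Ab; rewrite [lor a0 M]lorC; clear; lra.
split; [by []|by rewrite lorC|by rewrite lorC|by []|by []|].
by move/eqP: Y; rewrite subr_eq0 => /eqP.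
Qed.

Lemma dds_diff (f : 'rV[R]_2 -> 'rV[R]_4) p : differentiable f p -> dds f p = 'd f p (pt 1 0).
Proof. exact: deriveE. Qed.

Lemma ddt_diff (f : 'rV[R]_2 -> 'rV[R]_4) p : differentiable f p -> ddt f p = 'd f p (pt 0 1).
Proof. exact: deriveE. Qed.

Lemma ord2_lift : lift ord0 ord0 = 1 :> 'I_2.
Proof. exact: val_inj. Qed.

Lemma mxtrace2 (S : 'M[R]_2) : \tr S = S 0 0 + S 1 1.
Proof. by rewrite /mxtrace !big_ord_recl big_ord0 addr0 ord2_lift. Qed.

Lemma pt_mulmx (S : 'M[R]_2) (c d : R) : pt c d *m S =
  (c * S 0 0 + d * S 1 0) *: pt 1 0 + (c * S 0 1 + d * S 1 1) *: pt 0 1.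
Proof.
rewrite -ptE; apply/rowP => i; rewrite !mxE !big_ord_recl big_ord0 addr0 ord2_lift !mxE/=.
case: i => -[|[|]]// i.
  by rewrite (_ : Ordinal i = 0)//; exact: val_inj.
by rewrite (_ : Ordinal i = 1)//; exact: val_inj.
Qed.

Lemma shape_operator_pt (psi eta : 'rV[R]_2 -> 'rV[R]_4) p S :
  shape_operator psi eta p S ->
  'd eta p (pt 1 0) = - (S 0 0 *: 'd psi p (pt 1 0) + S 0 1 *: 'd psi p (pt 0 1)) /\
  'd eta p (pt 0 1) = - (S 1 0 *: 'd psi p (pt 1 0) + S 1 1 *: 'd psi p (pt 0 1)).
Proof.
move=> H; split; apply: etrans (H _) _; move: ('d psi p) => f.
  by rewrite pt_mulmx linearD !linearZ !mul1r !mul0r !addr0.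
by rewrite pt_mulmx linearD !linearZ !mul1r !mul0r !add0r.
Qed.

Lemma conformal_bryant_jet (D : set 'rV[R]_2) psi eta s t :
  conformal_bryant D psi eta -> D (pt s t) -> exists A M C,
  [/\ vdiff (fun x y => psi (pt x y)) s t (dds psi (pt s t)) (ddt psi (pt s t)),
      vdiff (fun x y => dds psi (pt x y)) s t A M,
      vdiff (fun x y => ddt psi (pt x y)) s t M C &
      bryant_jet (psi (pt s t)) (eta (pt s t)) (dds psi (pt s t)) (ddt psi (pt s t)) A C].
Proof.
case=> oD psiC etaC H3 imm S3 nt nn conf ori mc Dp.
have dpsi p : D p -> differentiable psi p by case: (psiC 1%N) => + _; exact.
have deta p : D p -> differentiable eta p by case: (etaC 1%N) => + _; exact.
have ddpsi (v : 'rV[R]_2) p : D p -> differentiable ('D_v psi) p.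
  by have [_ /(_ v)[+ _]] := psiC 2%N; exact.
have vpsi x y : D (pt x y) -> vdiff (fun x y => psi (pt x y)) x y (dds psi (pt x y)) (ddt psi (pt x y)).
  by move=> h; exact: differentiable_vdiff (dpsi (pt x y) h).
have va : vdiff (fun x y => dds psi (pt x y)) s t (dds (dds psi) (pt s t)) (ddt (dds psi) (pt s t)).
  exact: differentiable_vdiff (ddpsi (pt 1 0) _ Dp).
have vb : vdiff (fun x y => ddt psi (pt x y)) s t (dds (ddt psi) (pt s t)) (ddt (ddt psi) (pt s t)).
  exact: differentiable_vdiff (ddpsi (pt 0 1) _ Dp).
have [r r0 Dr] := open_square oD Dp.
have sym : ddt (dds psi) (pt s t) = dds (ddt psi) (pt s t).
  apply/rowP => i; apply: (@young R (fun x y => psi (pt x y) 0 i)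
    (fun x y => dds psi (pt x y) 0 i) (fun x y => ddt psi (pt x y) 0 i) s t r _ _ _ _ r0 _ (va i) (vb i)).
  move=> x y hx hy; have v1 := vpsi _ _ (Dr _ _ hx hy) i.
  by split; [exact: diff2_derive1 v1|exact: diff2_derive2 v1].
rewrite sym in va.
exists (dds (dds psi) (pt s t)), (dds (ddt psi) (pt s t)), (ddt (ddt psi) (pt s t)).
split; [exact: vpsi|exact: va|exact: vb|].
have [S HS trS] := mc _ Dp.
have Ea := dds_diff (dpsi _ Dp); have Eb := ddt_diff (dpsi _ Dp).
have [row1 row2] := shape_operator_pt HS.
apply: (@jet_of_equations (fun y z => D (pt y z)) (fun y z => psi (pt y z))
  (fun y z => eta (pt y z)) (fun y z => dds psi (pt y z)) (fun y z => ddt psi (pt y z)) s t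
  (dds eta (pt s t)) (ddt eta (pt s t)) _ _ _ (S 0 0) (S 0 1) (S 1 0) (S 1 1)).
- by move=> y z; exact: open_square.
- exact: vpsi.
- by move=> y z /H3[].
- by move=> y z; exact: nt.
- by move=> y z; exact: S3.
- move=> y z Dyz; have := nn _ Dyz => nD; split.
    exact: etrans (f_equal (lor _) (dds_diff (dpsi _ Dyz))) (nD _).
  exact: etrans (f_equal (lor _) (ddt_diff (dpsi _ Dyz))) (nD _).
- by move=> y z; exact: conf.
- exact: Dp.
- exact: ori.
- apply/eqP => a0; have := imm _ Dp; move=> /(_ (pt 1 0) 0); rewrite linear0.
  move=> /(_ (etrans (esym Ea) a0))/rowP/(_ 0).
  by rewrite !mxE/= => /eqP; rewrite oner_eq0.
- exact: differentiable_vdiff (deta _ Dp).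
- exact: va.
- exact: vb.
- exact: etrans (dds_diff (deta _ Dp)) (etrans row1
    (f_equal2 (fun u v => - (S 0 0 *: u + S 0 1 *: v)) (esym Ea) (esym Eb))).
- exact: etrans (ddt_diff (deta _ Dp)) (etrans row2
    (f_equal2 (fun u v => - (S 1 0 *: u + S 1 1 *: v)) (esym Ea) (esym Eb))).
- by move: trS; rewrite mxtrace2; clear; lra.
Qed.

End BryantEquation.

(** * Unique continuation of Bryant surfaces *)

Section BryantField.
Context {R : realType}.
Implicit Types (s t r : R).

(** The normal and the second derivatives are quantified at each point: the comparison of two
    surfaces uses only the relations they satisfy there. *)
Definition bryant_field (D : R -> R -> Prop) (x a b : R -> R -> 'rV[R]_4) :=
  forall s t, D s t -> vdiff x s t (a s t) (b s t) /\ exists h A M C,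
    [/\ vdiff a s t A M, vdiff b s t M C &
        bryant_jet (x s t) h (a s t) (b s t) A C].

Definition square_open (D : R -> R -> Prop) := forall s t, D s t ->
  exists2 r : R, 0 < r & forall y z, `|y - s| < r -> `|z - t| < r -> D y z.

Lemma bryant_field_mulmx D x a b (L : 'M[R]_4) :
  (forall u v, lor (u *m L) (v *m L) = lor u v) -> \det L = 1 ->
  bryant_field D x a b ->
  bryant_field D (fun s t => x s t *m L) (fun s t => a s t *m L) (fun s t => b s t *m L).
Proof.
move=> Liso detL H s t /H[vx [h [A [M [C [va vb J]]]]]]; split.
  exact: vdiff_mulmx.
exists (h *m L), (A *m L), (M *m L), (C *m L).
by split; [exact: vdiff_mulmx|exact: vdiff_mulmx|exact: bryant_jet_mulmx].
Qed.

Lemma form_cdiff D x a b j k l s t : bryant_field D x a b -> cyclic3 j k l -> D s t ->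
  exists c d, cdiff (fun y z => formRe j k l (x y z) (a y z) (b y z))
                    (fun y z => formIm j k l (x y z) (a y z) (b y z)) s t c d.
Proof.
move=> H cyc /H[vx [h [A [M [C [va vb J]]]]]].
have [E1 E2] := form_cauchy_riemann M cyc (jet_xa J) (jet_ha J) (jet_cross J) (jet_laplace J).
have d1 := formRe_diff j k l vx va vb; have d2 := formIm_diff j k l vx va vb.
by rewrite E1 E2 in d1; exists (formIm j k l (b s t) (a s t) (b s t) + formIm j k l (x s t) M C),
  (formIm j k l (a s t) (a s t) (b s t) + formIm j k l (x s t) A M).
Qed.

Lemma rV_subE (u v : 'rV[R]_4) i : (u - v) 0 i = u 0 i - v 0 i.
Proof. by rewrite !mxE. Qed.

Section Comparison.
Variables (D O : R -> R -> Prop) (x a b x2 a2 b2 : R -> R -> 'rV[R]_4).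
Variables (h1 h2 c d : R -> R -> R).
Hypotheses (oD : square_open D) (oO : square_open O).
Hypothesis hx : bryant_field D x a b.
Hypothesis hx2 : bryant_field O x2 a2 b2.
Hypothesis hh : forall s t, O s t -> cdiff h1 h2 s t (c s t) (d s t).
Hypothesis hO : forall s t, O s t -> D (h1 s t) (h2 s t).

Let x1 s t := x (h1 s t) (h2 s t).
Let a1 s t := c s t *: a (h1 s t) (h2 s t) + d s t *: b (h1 s t) (h2 s t).
Let b1 s t := - d s t *: a (h1 s t) (h2 s t) + c s t *: b (h1 s t) (h2 s t).
Let ERe j k l s t := formRe j k l (x1 s t) (a1 s t) (b1 s t)
                   - formRe j k l (x2 s t) (a2 s t) (b2 s t).
Let EIm j k l s t := formIm j k l (x1 s t) (a1 s t) (b1 s t)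
                   - formIm j k l (x2 s t) (a2 s t) (b2 s t).

Let x1_diff s t : O s t -> vdiff x1 s t (a1 s t) (b1 s t).
Proof.
move=> Ost i; have [vx _] := hx (hO Ost); have [d1 d2] := hh Ost.
by have := diff2_comp (vx i) d1 d2; rewrite /a1 /b1 !mxE; congr diff2; ring.
Qed.

Let x1_jet s t : O s t ->
  [/\ lor (x1 s t) (x1 s t) = -1, lor (x1 s t) (a1 s t) = 0 & lor (x1 s t) (b1 s t) = 0].
Proof.
move=> Ost; have [_ [h [A [M [C [_ _ J]]]]]] := hx (hO Ost).
have := jet_hyp J; have := jet_xa J; have := jet_xb J; rewrite /a1 /b1 => e1 e2 e3.
by split; rewrite // lorDr !lorZr e1 e2 !mulr0 addr0.
Qed.

Let x2_jet s t : O s t ->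
  [/\ lor (x2 s t) (x2 s t) = -1, lor (x2 s t) (a2 s t) = 0 & lor (x2 s t) (b2 s t) = 0].
Proof.
move=> Ost; have [_ [h [A [M [C [_ _ J]]]]]] := hx2 Ost.
by split; [exact: jet_hyp J|exact: jet_xa J|exact: jet_xb J].
Qed.

(* [h] is only assumed complex differentiable once, so [h' (form o h)] need not
   be visibly differentiable; it has a primitive nonetheless, the composite of
   [h] with a primitive of the form. *)
Let local_primitive j k l s0 t0 : cyclic3 j k l -> O s0 t0 ->
  exists2 r : R, 0 < r & exists f1 f2, forall s t, `|s - s0| < r -> `|t - t0| < r ->
    cdiff f1 f2 s t (ERe j k l s t) (EIm j k l s t).
Proof.
move=> cyc Op.
have [r1 r10 Dr1] := oD (hO Op); have [r2 r20 Or2] := oO Op.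
have half (r : R) : 0 < r -> 0 < r / 2 < r by move=> r0; apply/andP; split; lra.
have [F1 [F2 dF]] := cdiff_primitive (half _ r10)
  (fun s t h1 h2 => form_cdiff hx cyc (Dr1 s t h1 h2)).
have [G1 [G2 dG]] := cdiff_primitive (half _ r20)
  (fun s t h1 h2 => form_cdiff hx2 cyc (Or2 s t h1 h2)).
have [dh1 dh2] := hh Op.
have r14 : 0 < r1 / 4 by rewrite divr_gt0.
have [m1 m10 H1] := diff2_cont2 dh1 r14; have [m2 m20 H2] := diff2_cont2 dh2 r14.
have [m m0 [ma mb]] := small_pos m10 m20.
have r22 : 0 < r2 / 2 by rewrite divr_gt0.
have [r r0 [ra rb]] := small_pos m0 r22.
exists r => //; exists (fun s t => F1 (h1 s t) (h2 s t) - G1 s t),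
  (fun s t => F2 (h1 s t) (h2 s t) - G2 s t) => s t hs ht.
have q4 : r1 / 4 < r1 / 2 by lra.
have Ost : O s t by apply: Or2; lra.
have K1 := le_lt_trans (H1 s t (lt_trans hs (lt_trans ra ma)) (lt_trans ht (lt_trans ra ma))) q4.
have K2 := le_lt_trans (H2 s t (lt_trans hs (lt_trans ra mb)) (lt_trans ht (lt_trans ra mb))) q4.
have dcomp := cdiff_comp (dF _ _ K1 K2) (hh Ost).
have dsub := cdiffB dcomp (dG _ _ (lt_trans hs rb) (lt_trans ht rb)).
have [e1 e2] := form_rotate j k l (x1 s t) (a (h1 s t) (h2 s t)) (b (h1 s t) (h2 s t)) (c s t) (d s t).
by rewrite /ERe /EIm /a1 /b1 e1 e2.
Qed.

Let sqn (v : 'rV[R]_4) := v 0 o0 ^+ 2 + v 0 o1 ^+ 2 + v 0 o2 ^+ 2 + v 0 o3 ^+ 2.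

Let sqn0 (v : 'rV[R]_4) : sqn v = 0 -> v = 0.
Proof.
rewrite /sqn => H; have z (e : R) : e ^+ 2 = 0 -> e = 0 by move/eqP; rewrite sqrf_eq0 => /eqP.
have := sqr_ge0 (v 0 o0); have := sqr_ge0 (v 0 o1); have := sqr_ge0 (v 0 o2).
have := sqr_ge0 (v 0 o3) => e1 e2 e3 e4.
by apply/rowP; apply: forall_ord4; rewrite mxE; apply: z; lra.
Qed.

Let sqn_diff (f : R -> R -> 'rV[R]_4) s t u v : vdiff f s t u v ->
  diff2 (fun s t => sqn (f s t)) s t
   (2 * (f s t 0 o0 * u 0 o0 + f s t 0 o1 * u 0 o1 + f s t 0 o2 * u 0 o2 + f s t 0 o3 * u 0 o3))
   (2 * (f s t 0 o0 * v 0 o0 + f s t 0 o1 * v 0 o1 + f s t 0 o2 * v 0 o2 + f s t 0 o3 * v 0 o3)).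
Proof.
move=> H; have sq i := diff2M (H i) (H i).
by have := diff2D (diff2D (diff2D (sq o0) (sq o1)) (sq o2)) (sq o3); congr diff2; ring.
Qed.

Lemma cyc1 : cyclic3 o1 o2 o3. Proof. by constructor 1. Qed.
Lemma cyc2 : cyclic3 o2 o3 o1. Proof. by constructor 2. Qed.
Lemma cyc3 : cyclic3 o3 o1 o2. Proof. by constructor 3. Qed.

(** Each product obeys [4 |p y0 y| <= 2 B (y0^2 + y^2)]; the square of [y0] is counted three times,
    hence the 6. *)
Let gron_bound (p1 p2 p3 y0 y1 y2 y3 B : R) : `|p1| <= B -> `|p2| <= B -> `|p3| <= B ->
  `|4 * (y0 * (p1 * y1 + p2 * y2 + p3 * y3))| <= 6 * B * (y0 ^+ 2 + y1 ^+ 2 + y2 ^+ 2 + y3 ^+ 2).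
Proof.
move=> b1' b2' b3'.
have B0 : 0 <= B by apply: le_trans b1'.
have K (p y : R) : `|p| <= B -> `|4 * (y0 * (p * y))| <= 2 * B * (y0 ^+ 2 + y ^+ 2).
  move=> pB; rewrite !normrM (ger0_norm (ler0n R 4)).
  have h := mulr_ge0 (normr_ge0 y0) (normr_ge0 y).
  have hpB := ler_wpM2r h pB.
  have := sqr_ge0 (`|y0| - `|y|).
  rewrite -[y0 ^+ 2]real_normK ?num_real// -[y ^+ 2]real_normK ?num_real// => sq.
  have := mulr_ge0 B0 sq; move: hpB.
  by lra.
have := K _ y1 b1'; have := K _ y2 b2'; have := K _ y3 b3'.
rewrite (_ : 4 * (y0 * (p1 * y1 + p2 * y2 + p3 * y3)) =
  4 * (y0 * (p1 * y1)) + 4 * (y0 * (p2 * y2)) + 4 * (y0 * (p3 * y3))); last by ring.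
move=> k3 k2 k1; apply: (le_trans (ler_normD _ _)).
apply: (le_trans (lerD (ler_normD _ _) (lexx _))).
have := mulr_ge0 B0 (sqr_ge0 y1); have := mulr_ge0 B0 (sqr_ge0 y2).
have := mulr_ge0 B0 (sqr_ge0 y3); have := mulr_ge0 B0 (sqr_ge0 y0).
by move: k1 k2 k3; lra.
Qed.

(* The form and the value of [x] at one point determine [x]: the equation
   [dX = (dX X^-1) X] is linear in [x]. *)
Let same_form s0 t0 r B y z :
  (forall s t, `|s - s0| < r -> `|t - t0| < r -> O s t) ->
  (forall j k l s t, cyclic3 j k l -> `|s - s0| < r -> `|t - t0| < r ->
     [/\ ERe j k l s t = 0, EIm j k l s t = 0,
         `|formRe j k l (x2 s t) (a2 s t) (b2 s t)| <= B
       & `|formIm j k l (x2 s t) (a2 s t) (b2 s t)| <= B]) ->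
  `|y - s0| < r -> `|z - t0| < r -> x1 y z = x2 y z ->
  forall s t, `|s - s0| < r -> `|t - t0| < r -> x1 s t = x2 s t.
Proof.
move=> Or HE yr zr E0 s t sr tr.
pose X s t := x1 s t - x2 s t.
have dX s' t' : O s' t' -> vdiff X s' t' (a1 s' t' - a2 s' t') (b1 s' t' - b2 s' t').
  move=> Ost i; have [v2 _] := hx2 Ost.
  have := diff2B (x1_diff Ost i) (v2 i); rewrite !rV_subE => H.
  by apply: diff2_ext H; exists 1 => // *; rewrite rV_subE.
(* As the forms agree, [form_reconstruct] gives a linear system for [X]. Its cross product terms are
   orthogonal to the spatial part of [X] and drop out of the derivative of the Euclidean square. *)
have rec s' t' : `|s' - s0| < r -> `|t' - t0| < r ->
  exists p1 p2 p3 q1 q2 q3 : R,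
   [/\ [/\ `|p1| <= B, `|p2| <= B & `|p3| <= B], [/\ `|q1| <= B, `|q2| <= B & `|q3| <= B] &
    diff2 (fun s t => sqn (X s t)) s' t'
     (4 * (X s' t' 0 o0 * (p1 * X s' t' 0 o1 + p2 * X s' t' 0 o2 + p3 * X s' t' 0 o3)))
     (- (4 * (X s' t' 0 o0 * (q1 * X s' t' 0 o1 + q2 * X s' t' 0 o2 + q3 * X s' t' 0 o3))))].
  move=> hs ht; have Ost := Or _ _ hs ht.
  have [e1 f1 m1 n1] := HE _ _ _ _ _ cyc1 hs ht.
  have [e2 f2 m2 n2] := HE _ _ _ _ _ cyc2 hs ht.
  have [e3 f3 m3 n3] := HE _ _ _ _ _ cyc3 hs ht.
  have [xx1 xa1 xb1] := x1_jet Ost; have [xx2 xa2 xb2] := x2_jet Ost.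
  have R1 := form_reconstruct cyc1 xx1 xa1 xb1.
  have R2 := form_reconstruct cyc2 xx1 xa1 xb1.
  have R3 := form_reconstruct cyc3 xx1 xa1 xb1.
  have S1 := form_reconstruct cyc1 xx2 xa2 xb2.
  have S2 := form_reconstruct cyc2 xx2 xa2 xb2.
  have S3 := form_reconstruct cyc3 xx2 xa2 xb2.
  have {}e1 := subr0_eq e1; have {}f1 := subr0_eq f1; have {}e2 := subr0_eq e2.
  have {}f2 := subr0_eq f2; have {}e3 := subr0_eq e3; have {}f3 := subr0_eq f3.
  rewrite /= in R1 R2 R3 S1 S2 S3.
  rewrite e1 e2 e3 f1 f2 f3 in R1 R2 R3.
  move: R1 R2 R3 S1 S2 S3 m1 m2 m3 n1 n2 n3.
  set p1 := formRe o1 _ _ _ _ _; set p2 := formRe o2 _ _ _ _ _; set p3 := formRe o3 _ _ _ _ _.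
  set q1 := formIm o1 _ _ _ _ _; set q2 := formIm o2 _ _ _ _ _; set q3 := formIm o3 _ _ _ _ _.
  move=> [r0 r1 r0' r1'] [_ r2 _ r2'] [_ r3 _ r3'] [k0 k1 k0' k1'] [_ k2 _ k2'] [_ k3 _ k3'].
  move=> m1 m2 m3 n1 n2 n3.
  exists p1, p2, p3, q1, q2, q3; split=> //.
  have := sqn_diff (dX _ _ Ost); congr diff2; rewrite /X !rV_subE.
    by rewrite r0 r1 r2 r3 k0 k1 k2 k3; ring.
  by rewrite r0' r1' r2' r3' k0' k1' k2' k3'; ring.
have sqn_ge v : 0 <= sqn v by rewrite /sqn !addr_ge0 ?sqr_ge0.
have base : sqn (X y z) = 0 by rewrite /X E0 subrr /sqn !mxE expr0n !addr0.
have /choice[gs gsP] : forall s', exists g : R, `|s' - s0| < r ->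
    is_derive s' (1 : R) (fun s => sqn (X s z)) g /\ `|g| <= 6 * B * sqn (X s' z).
  move=> s'; have [hs|/negP hs] := boolP (`|s' - s0| < r); last by exists 0.
  have [p1 [p2 [p3 [q1 [q2 [q3 [[b1' b2' b3'] _ /diff2_derive1 dd]]]]]]] := rec s' z hs zr.
  by eexists => _; split; [exact: dd|exact: gron_bound].
(* Gronwall along the horizontal line at height [z], and then along the vertical line at [s]. *)
have step1 : sqn (X s z) = 0.
  apply: (@gronwall R (fun s => sqn (X s z)) gs s0 r y (6 * B)) => //.
  - by move=> s' /gsP[].
  - by move=> s' /gsP[].
have /choice[gt gtP] : forall t', exists g : R, `|t' - t0| < r ->
    is_derive t' (1 : R) (fun t => sqn (X s t)) g /\ `|g| <= 6 * B * sqn (X s t').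
  move=> t'; have [ht|/negP ht] := boolP (`|t' - t0| < r); last by exists 0.
  have [p1 [p2 [p3 [q1 [q2 [q3 [_ [b1' b2' b3'] /diff2_derive2 dd]]]]]]] := rec s t' sr ht.
  by eexists => _; split; [exact: dd|rewrite normrN; exact: gron_bound].
have step2 : sqn (X s t) = 0.
  apply: (@gronwall R (fun t => sqn (X s t)) gt t0 r z (6 * B)) => //.
  - by move=> t' /gtP[].
  - by move=> t' /gtP[].
by have /sqn0/eqP := step2; rewrite subr_eq0 => /eqP.
Qed.

(** The second conclusion starts the continuation on the axis; the first, where the point of
    coincidence may be anywhere in the square, makes the coincidence set closed. All small [r] are
    allowed so that the axis segment of radius [8 * r] can be fitted into the interval. *)
Lemma field_unique_continuation s0 t0 : O s0 t0 -> exists2 q : R, 0 < q &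
  forall r, 0 < r -> r <= q ->
  (forall y z, `|y - s0| < r -> `|z - t0| < r ->
    (exists2 e : R, 0 < e & forall s t, `|s - y| < e -> `|t - z| < e -> x1 s t = x2 s t) ->
    forall s t, `|s - s0| < r -> `|t - t0| < r -> x1 s t = x2 s t) /\
  ((forall s, `|s - s0| < 8 * r ->
     [/\ x1 s t0 = x2 s t0, a1 s t0 = a2 s t0 & b1 s t0 = b2 s t0]) ->
    forall s t, `|s - s0| < r -> `|t - t0| < r -> x1 s t = x2 s t).
Proof.
move=> Op; have [r1 r10 Or1] := oO Op.
have prim j k l (cyc : cyclic3 j k l) := local_primitive cyc Op.
have bnd j k l : cyclic3 j k l -> exists2 r : R, 0 < r & exists B : R, forall s t,
    `|s - s0| < r -> `|t - t0| < r ->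
    `|formRe j k l (x2 s t) (a2 s t) (b2 s t)| <= B /\
    `|formIm j k l (x2 s t) (a2 s t) (b2 s t)| <= B.
  move=> cyc; have [c0 [d0 [/diff2_cont2 C1 /diff2_cont2 C2]]] := form_cdiff hx2 cyc Op.
  have [m1 m10 H1] := C1 1 ltr01; have [m2 m20 H2] := C2 1 ltr01.
  have [m m0 [ma mb]] := small_pos m10 m20; exists m => //.
  set p := formRe _ _ _ _ _ _ in H1; set q := formIm _ _ _ _ _ _ in H2.
  exists (`|p| + `|q| + 1) => s t hs ht.
  have := H1 s t (lt_trans hs ma) (lt_trans ht ma).
  have := H2 s t (lt_trans hs mb) (lt_trans ht mb).
  have := ler_normD (formRe j k l (x2 s t) (a2 s t) (b2 s t) - p) p.
  have := ler_normD (formIm j k l (x2 s t) (a2 s t) (b2 s t) - q) q.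
  by rewrite !subrK; have := normr_ge0 p; have := normr_ge0 q; split; lra.
have all3 (P : 'I_4 -> 'I_4 -> 'I_4 -> R -> Prop) :
    (forall j k l, cyclic3 j k l -> exists2 r : R, 0 < r & P j k l r) ->
    (forall j k l r r', r' <= r -> P j k l r -> P j k l r') ->
    exists2 r : R, 0 < r & forall j k l, cyclic3 j k l -> P j k l r.
  move=> H mono; have [n1 n10 P1] := H _ _ _ cyc1; have [n2 n20 P2] := H _ _ _ cyc2.
  have [n3 n30 P3] := H _ _ _ cyc3; have [m m0 [ma mb]] := small_pos n10 n20.
  have [n n0 [na nb]] := small_pos m0 n30; exists n => // j k l.
  case=> -[-> -> ->].
  - by apply: mono P1; apply/ltW/(lt_trans na).
  - by apply: mono P2; apply/ltW/(lt_trans na).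
  - by apply: mono P3; exact: ltW.
have [r2 r20 P2] := all3 _ prim ltac:(move=> j k l r r' rr [f1 [f2 Hf]]; exists f1, f2 => s t hs ht;
  exact: Hf (lt_le_trans hs rr) (lt_le_trans ht rr)).
have [r3 r30 P3] := all3 _ bnd ltac:(move=> j k l r r' rr [B HB]; exists B => s t hs ht;
  exact: HB (lt_le_trans hs rr) (lt_le_trans ht rr)).
have [m m0 [ma mb]] := small_pos r10 r20; have [n n0 [na nb]] := small_pos m0 r30.
exists (n / 8) => [|r r0 rn]; first by rewrite divr_gt0.
have r8 : 8 * r <= n by lra.
have lt1 u : u < 8 * r -> u < r1 by move=> h; lra.
have lt2 u : u < 8 * r -> u < r2 by move=> h; lra.
have lt3 u : u < r -> u < r3 by move=> h; lra.
have lt8 u : u < r -> u < 8 * r by move=> h; lra.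
have Or s t : `|s - s0| < 8 * r -> `|t - t0| < 8 * r -> O s t.
  by move=> hs ht; apply: Or1; exact: lt1.
have [B HB] : exists B : R, forall j k l s t, cyclic3 j k l -> `|s - s0| < r -> `|t - t0| < r ->
    `|formRe j k l (x2 s t) (a2 s t) (b2 s t)| <= B /\
    `|formIm j k l (x2 s t) (a2 s t) (b2 s t)| <= B.
  have [B1 H1] := P3 _ _ _ cyc1; have [B2 H2] := P3 _ _ _ cyc2; have [B3 H3] := P3 _ _ _ cyc3.
  have T1 u : u <= B1 -> u <= `|B1| + `|B2| + `|B3|.
    by move=> h; rewrite -addrA (le_trans h)// (le_trans (ler_norm _))// lerDl addr_ge0.
  have T2 u : u <= B2 -> u <= `|B1| + `|B2| + `|B3|.
    by move=> h; rewrite addrAC (le_trans h)// (le_trans (ler_norm _))// lerDr addr_ge0.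
  have T3 u : u <= B3 -> u <= `|B1| + `|B2| + `|B3|.
    by move=> h; rewrite (le_trans h)// (le_trans (ler_norm _))// lerDr addr_ge0.
  exists (`|B1| + `|B2| + `|B3|) => j k l s t cyc hs ht.
  have [u1 v1] := H1 s t (lt3 _ hs) (lt3 _ ht).
  have [u2 v2] := H2 s t (lt3 _ hs) (lt3 _ ht).
  have [u3 v3] := H3 s t (lt3 _ hs) (lt3 _ ht).
  case: cyc => -[-> -> ->]; split;
    by [exact: T1|exact: T2|exact: T3].
have finish y z : `|y - s0| < r -> `|z - t0| < r -> x1 y z = x2 y z ->
    (forall j k l, cyclic3 j k l -> forall s t, `|s - s0| < r -> `|t - t0| < r ->
       ERe j k l s t = 0 /\ EIm j k l s t = 0) ->
    forall s t, `|s - s0| < r -> `|t - t0| < r -> x1 s t = x2 s t.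
  move=> hy hz E0 HE; apply: (@same_form s0 t0 r B y z) => //.
    by move=> s t hs ht; apply: Or; exact: lt8.
  move=> j k l s t cyc hs ht; have [e1 e2] := HE _ _ _ cyc s t hs ht.
  by have [u1 u2] := HB _ _ _ s t cyc hs ht; split.
have pos0 (u : R) : `|u - u| < r by rewrite subrr normr0.
split=> [y z hy hz [e e0 He]|Hax].
  apply: (finish y z) => //; first by apply: He; rewrite subrr normr0.
  move=> j k l cyc; have [f1 [f2 Hf]] := P2 _ _ _ cyc.
  have u1 : 0 < 8 * r - `|y - s0| by rewrite subr_gt0 lt8.
  have u2 : 0 < 8 * r - `|z - t0| by rewrite subr_gt0 lt8.
  have [u u0 [ua ub]] := small_pos u1 u2; have [v v0 [va vb]] := small_pos u0 e0.
  apply: (@derivative_identity R f1 f2 (ERe j k l) (EIm j k l) s0 t0 r y z v r0 v0 _ hy hz).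
    by move=> s t hs ht; apply: Hf; exact: lt2.
  move=> s t hs ht.
  have Ost : O s t.
    by apply: Or; apply: ball_near; [exact: lt_trans hs (lt_trans va ua)|exact: lt_trans ht (lt_trans va ub)].
  have w1 : 0 < v - `|s - y| by rewrite subr_gt0.
  have w2 : 0 < v - `|t - z| by rewrite subr_gt0.
  have [w w0 [wa wb]] := small_pos w1 w2.
  have E12 s' t' : `|s' - s| < w -> `|t' - t| < w -> x1 s' t' = x2 s' t'.
    move=> hs' ht'; apply: He; apply: (lt_trans _ vb); apply: ball_near.
      exact: lt_trans hs' wa.
    exact: lt_trans ht' wb.
  have [v2 _] := hx2 Ost; have v1 := x1_diff Ost.
  have ab i : a1 s t 0 i = a2 s t 0 i /\ b1 s t 0 i = b2 s t 0 i.
    apply: diff2_unique (v1 i) _; apply: diff2_ext (v2 i).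
    by exists w => // s' t' hs' ht'; rewrite E12.
  have a12 : a1 s t = a2 s t by apply/rowP => i; have [] := ab i.
  have b12 : b1 s t = b2 s t by apply/rowP => i; have [] := ab i.
  by rewrite /ERe /EIm a12 b12 E12 ?subrr// normr0.
apply: (finish s0 t0) => //.
  by have [] := Hax s0 (lt8 _ (pos0 s0)).
move=> j k l cyc; have [f1 [f2 Hf]] := P2 _ _ _ cyc.
apply: (@axis_identity R f1 f2 (ERe j k l) (EIm j k l) s0 t0 r r0).
  by move=> s t hs ht; apply: Hf; exact: lt2.
by move=> s hs; have [ex ea eb] := Hax s hs; rewrite /ERe /EIm ex ea eb !subrr.
Qed.

End Comparison.

End BryantField.

(** * Derivative of a linear motion *)

Section LinearMaps.
Context {R : realType}.

Lemma mulmx_continuous (L : 'M[R]_4) : continuous (fun x : 'rV[R]_4 => x *m L).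
Proof.
have -> : (fun x : 'rV[R]_4 => x *m L) = fun x : 'rV[R]_4 => x 0 o0 *: row o0 L
    + x 0 o1 *: row o1 L + x 0 o2 *: row o2 L + x 0 o3 *: row o3 L.
  by apply/funext => x; rewrite mulmx_sum_row sum_ord4.
move=> x; have c i : (fun y : 'rV[R]_4 => y 0 i *: row i L) @ x --> x 0 i *: row i L.
  exact: (cvgZr_tmp (@coord_continuous R 1 4 0 i x)).
exact: (cvgD (cvgD (cvgD (c o0) (c o1)) (c o2)) (c o3)).
Qed.

Lemma diff_mulmx (L : 'M[R]_4) (x v : 'rV[R]_4) : 'd (fun x : 'rV[R]_4 => x *m L) x v = v *m L.
Proof.
have c : continuous (mulmxr L : 'rV[R]_4 -> 'rV[R]_4) by exact: mulmx_continuous.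
exact: (f_equal (fun f => f v) (diff_lin x c)).
Qed.

Lemma crossZ (u v w : 'rV[R]_4) (c : R) : cross u v (c *: w) = c *: cross u v w.
Proof.
have [c0 c1 c2 c3] := crossE u v (c *: w); have [d0 d1 d2 d3] := crossE u v w.
apply/rowP; apply: forall_ord4; rewrite [RHS]mxE.
- by rewrite c0 d0 !mxE /det3; ring.
- by rewrite c1 d1 !mxE /det3; ring.
- by rewrite c2 d2 !mxE /det3; ring.
- by rewrite c3 d3 !mxE /det3; ring.
Qed.

End LinearMaps.

(** * The symmetry on a connected domain *)

Theorem theorem11 (R : realType) (I : set R) (beta V : R -> 'rV[R]_4)
    (Phi : 'rV[R]_4 -> 'rV[R]_4) (Psi : R -> R)
    (D : set 'rV[R]_2) (psi eta : 'rV[R]_2 -> 'rV[R]_4)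
    (U : set 'rV[R]_2) (tPsi : 'rV[R]_2 -> 'rV[R]_2)
    (hI : open_interval I)
    (hdata : bjorling_data I beta V)
    (hPhi : positive_rigid_motion Phi)
    (hPsi : analytic_diffeo I Psi)
    (hbeta : forall s, I s -> beta (Psi s) = Phi (beta s))
    (hV : forall s, I s -> V (Psi s) = 'd Phi (beta s) (V s))
    (hpsi : cauchy_solution I beta V D psi eta)
    (htPsi : holomorphic_extension I Psi U tPsi) :
  forall W : set 'rV[R]_2,
    connected W -> axis I `<=` W -> W `<=` D `&` U `&` tPsi @^-1` D ->
    forall p, W p -> psi (tPsi p) = Phi (psi p).
Proof.
move=> W cW IW WO.
have [L [Liso _ detL PhiE]] := hPhi.
have [cB aD psiI etaI] := hpsi; have [oU aU holU tI] := htPsi.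
have [_ oI I0] := hI; have [[bij1 _ _] _ _] := hPsi.
have oD := bryant_open cB.
pose x s t := psi (pt s t); pose a s t := dds psi (pt s t).
pose b s t := ddt psi (pt s t); pose h s t := eta (pt s t).
pose D2 s t := D (pt s t).
pose h1 s t := tPsi (pt s t) 0 0; pose h2 s t := tPsi (pt s t) 0 1.
pose O s t := [/\ D (pt s t), U (pt s t) & D (tPsi (pt s t))].
have hh s t : tPsi (pt s t) = pt (h1 s t) (h2 s t) by rewrite ptK.
have fx : bryant_field D2 x a b.
  move=> s t Dst; have [A [M [C [vx va vb J]]]] := conformal_bryant_jet cB Dst.
  by split; [exact: vx|exists (h s t), A, M, C].
have crossx s t : D2 s t -> b s t = cross (x s t) (h s t) (a s t).
  exact: (bryant_orientation cB).
have xE s t : psi (pt s t) = x s t by [].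
have xI s : I s -> x s 0 = beta s by exact: psiI.
have hIV s : I s -> h s 0 = V s by exact: etaI.
clearbody x a b h.
have oD2 : square_open D2 by move=> s t; exact: open_square.
have /choice[cd cdP] : forall z : R * R, exists w : R * R, U (pt z.1 z.2) ->
    cdiff h1 h2 z.1 z.2 w.1 w.2.
  move=> [s t]; have [Ust|nU] := pselect (U (pt s t)); last by exists (0, 0).
  by have [c [d H]] := holomorphic_cdiff holU Ust; exists (c, d).
pose c s t := (cd (s, t)).1; pose d s t := (cd (s, t)).2.
have dh s t : O s t -> cdiff h1 h2 s t (c s t) (d s t).
  by case=> _ Ust _; exact: (cdP (s, t)).
have hD s t : O s t -> D2 (h1 s t) (h2 s t) by case; rewrite /D2 -hh.
have oO : square_open O.
  move=> s t Ost; have [Dst Ust DT] := Ost.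
  have [r1 r10 H1] := open_square oD Dst; have [r2 r20 H2] := open_square oU Ust.
  have [r3 r30 H3] := oD2 _ _ (hD _ _ Ost).
  have r32 : 0 < r3 / 2 by rewrite divr_gt0.
  have [/diff2_cont2/(_ _ r32)[r4 r40 H4] /diff2_cont2/(_ _ r32)[r5 r50 H5]] := dh _ _ Ost.
  have [m m0 [ma mb]] := small_pos r10 r20; have [n n0 [na nb]] := small_pos r40 r50.
  have [r r0 [rm rn]] := small_pos m0 n0; exists r => // y z hy hz.
  have lt (u v : R) : u < r -> r < v -> u < v by exact: lt_trans.
  have [l1 l2 l4 l5] : [/\ r < r1, r < r2, r < r4 & r < r5].
    by split; [exact: lt_trans ma|exact: lt_trans mb|exact: lt_trans na|exact: lt_trans nb].
  have r3h : r3 / 2 < r3 by lra.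
  split; [exact: (H1 _ _ (lt _ _ hy l1) (lt _ _ hz l1))|exact: (H2 _ _ (lt _ _ hy l2) (lt _ _ hz l2))|].
  rewrite hh; apply: H3; apply: le_lt_trans r3h.
    exact: (H4 _ _ (lt _ _ hy l4) (lt _ _ hz l4)).
  exact: (H5 _ _ (lt _ _ hy l5) (lt _ _ hz l5)).
pose x2 s t := x s t *m L; pose a2 s t := a s t *m L; pose b2 s t := b s t *m L.
have fx2 : bryant_field O x2 a2 b2.
  by move=> s t [Dst _ _]; exact: (bryant_field_mulmx Liso detL fx).
pose x1 s t := x (h1 s t) (h2 s t).
pose a1 s t := c s t *: a (h1 s t) (h2 s t) + d s t *: b (h1 s t) (h2 s t).
pose b1 s t := - d s t *: a (h1 s t) (h2 s t) + c s t *: b (h1 s t) (h2 s t).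
have key s t (Ost : O s t) := field_unique_continuation oD2 oO fx fx2 dh hD Ost.
have Iax s : I s -> O s 0.
  move=> Is; have Ws : W (pt s 0) by apply: IW; exists s.
  by have [[h3 h4] h5] := WO _ Ws; split.
have hax s : I s -> h1 s 0 = Psi s /\ h2 s 0 = 0.
  by move=> Is; rewrite /h1 /h2 tI// !mxE.
have PhiM u v : 'd Phi u v = v *m L by rewrite PhiE; exact: diff_mulmx.
have xax s : I s -> x1 s 0 = x2 s 0.
  move=> Is; have [e1 e2] := hax s Is; have IPs : I (Psi s) by exact: bij1.
  by rewrite /x1 /x2 e1 e2 !xI// hbeta// PhiE.
have [Ir IrP] : exists Ir : R -> R, forall s, I s ->
    0 < Ir s /\ forall s', `|s' - s| < Ir s -> I s'.
  have /choice[Ir H] : forall s, exists r : R, I s ->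
      0 < r /\ forall s', `|s' - s| < r -> I s'.
    move=> s; have [Is|nI] := pselect (I s); last by exists 0.
    have /nbhs_ballP[r /= r0 Hr] := open_nbhs_nbhs (conj oI Is).
    by exists r => _; split=> // s' hs'; apply: Hr; rewrite /ball/= distrC.
  by exists Ir.
have axE s : I s -> [/\ x1 s 0 = x2 s 0, a1 s 0 = a2 s 0 & b1 s 0 = b2 s 0].
  move=> Is; have [r0 HI] := IrP s Is; have Os := Iax s Is.
  have [e1 e2] := hax s Is; have IPs : I (Psi s) by exact: bij1.
  have [_ dh2] := dh _ _ Os.
  (* [tPsi] maps the axis to itself, so its complex derivative is real there. *)
  have d0 : d s 0 = 0.
    have /is_derive_epsP D0 : is_derive s (1 : R) (fun=> 0 : R) 0 by exact: is_derive_cst.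
    apply: is_derive_unique (diff2_derive1 dh2) _; apply/is_derive_epsP => e e0.
    exists (Ir s) => // y hy; have [_ ->] := hax y (HI y hy); rewrite e2.
    by rewrite subrr mul0r subr0 normr0 mulr_ge0// ltW.
  have a12 : a1 s 0 = a2 s 0.
    have v1 : vdiff x1 s 0 (a1 s 0) (b1 s 0).
      move=> i; have [vx _] := fx _ _ (hD _ _ Os); have [d1 d2] := dh _ _ Os.
      by have := diff2_comp (vx i) d1 d2; rewrite /a1 /b1 !mxE; congr diff2; ring.
    have [v2 _] := fx2 _ _ Os.
    apply/rowP => i; have /diff2_derive1/is_derive_epsP D1 := v1 i.
    apply: is_derive_unique (diff2_derive1 (v2 i)).
    apply/is_derive_epsP => e e0; have [q q0 Hq] := D1 e e0.
    have [m m0 [ma mb]] := small_pos q0 r0; exists m => // y hy.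
    have := Hq y (lt_trans hy ma).
    by rewrite !xax//; apply: HI; exact: lt_trans mb.
  split; [exact: xax|exact: a12|].
  (* With a real derivative, [a] and [b] are scaled by the same factor [c], so the orientation
     relation survives, even where [c] vanishes. *)
  have bE : b1 s 0 = cross (x1 s 0) (h (h1 s 0) (h2 s 0)) (a1 s 0).
    by rewrite /b1 /a1 d0 oppr0 !scale0r add0r addr0 crossZ -crossx//; exact: hD.
  have hE : h (h1 s 0) (h2 s 0) = h s 0 *m L.
    by rewrite e1 e2 !hIV// hV// PhiM.
  rewrite bE hE a12 xax// /x2 /a2 /b2 cross_mulmx// -crossx//.
  by case: Os.
pose A : set 'rV[R]_2 := [set p | exists2 e : R, 0 < e & forall s t,
   `|s - p 0 0| < e -> `|t - p 0 1| < e -> x1 s t = x2 s t].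
have ptA s t e : 0 < e -> (forall y z, `|y - s| < e -> `|z - t| < e -> x1 y z = x2 y z) ->
    A (pt s t).
  by move=> e0 He; exists e => // y z; rewrite !mxE/=; exact: He.
have oA : open A.
  rewrite openE => p [e e0 He]; rewrite /interior -(ptK p).
  apply: (@square_nbhs R _ _ e) => // s t hs ht.
  have m10 : 0 < e - `|s - p 0 0| by rewrite subr_gt0.
  have m20 : 0 < e - `|t - p 0 1| by rewrite subr_gt0.
  have [m m0 [ma mb]] := small_pos m10 m20.
  apply: (ptA s t m m0) => y z hy hz; apply: He; apply: ball_near.
    exact: lt_trans hy ma.
  exact: lt_trans hz mb.
have WO' p : W p -> O (p 0 0) (p 0 1).
  by move=> /WO[[? ?] ?]; split; rewrite ptK.
(* The interior [A] of the coincidence set meets [W] in a nonempty, relatively open and relatively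
   closed subset. *)
have WA : W `&` A = W.
  apply: cW.
  - have [s Is] := I0; have Os := Iax s Is; have [r0 HI] := IrP s Is.
    exists (pt s 0); split; first by apply: IW; exists s.
    have [q q0 Hq] := key _ _ Os.
    have I8 : 0 < Ir s / 8 by rewrite divr_gt0.
    have [m m0 [ma mb]] := small_pos q0 I8.
    have [_ Hm] := Hq m m0 (ltW ma).
    apply: (ptA s 0 m m0); apply: Hm => s' hs'; apply: axE; apply: HI; lra.
  - by exists A.
  exists (closure A); first exact: closed_closure.
  apply/seteqP; split=> [p [Wp Ap]|p [Wp Ap]].
    by split=> //; exact: subset_closure.
  (* The continuation square is centred at the limit point [p], which may lie outside [A]; being a
     neighbourhood of [p] it contains a point of [A], from which the coincidence spreads to the
     whole square. *)
  split=> //; have Op := WO' p Wp; have [q q0 Hq] := key _ _ Op.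
  have [Hi _] := Hq q q0 (lexx q).
  have nb : nbhs p [set p' : 'rV[R]_2 | `|p' 0 0 - p 0 0| < q /\ `|p' 0 1 - p 0 1| < q].
    rewrite -[X in nbhs X](ptK p); apply: (@square_nbhs R _ _ q) => // s t hs ht.
    by rewrite /= !mxE.
  have [p' [[e e0 He] [hp1 hp2]]] := Ap _ nb.
  by exists q => // s t; apply: (Hi _ _ hp1 hp2); exists e.
move=> p Wp; have [_ [e e0 He]] : (W `&` A) p by rewrite WA.
have := He (p 0 0) (p 0 1); rewrite !subrr normr0 => /(_ e0 e0).
by rewrite /x1 /x2 -!xE -hh !ptK PhiE.
Qed.
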